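(* Let $\mu_\infty$ be defined on compact sets $K\subset\mathbf{C}_\infty$ by $\mu_\infty(K)=\lim_{r\to\infty}\mu_r(Q_rK)$, and for arbitrary $A\in\mathfrak{C}_\infty$ by $\mu_\infty(A)=\sup\{\mu_\infty(K): K\subset A,\ K\text{ compact}\}$. Then $\mu_\infty$ is a (countably additive) probability measure on $(\mathbf{C}_\infty,\mathfrak{C}_\infty)$.
   Context: $\mathbf{C}_\infty$ is the space of real continuous functions on $[0,\infty)$ vanishing at $0$, with the metric $d(f,g)=\sum_{n=1}^\infty 2^{-n}\frac{\sup_{0\le t\le n}|f(t)-g(t)|}{1+\sup_{0\le t\le n}|f(t)-g(t)|}$ and Borel $\sigma$-field $\mathfrak{C}_\infty$. For $a>0$, $\mathbf{C}_a$ is the space of real continuous functions on $[0,a]$ vanishing at $0$, with the sup norm and Borel $\sigma$-field $\mathfrak{C}_a$. For an integer $r\ge1$, $Q_r:\mathbf{C}_\infty\to\mathbf{C}_r$ is the restriction map $Q_rf(t)=f(t)$, $0\le t\le r$. The measure $\mu_r$ on $\mathfrak{C}_r$ is the (Wiener) probability measure $\mu$ obtained by taking $a=r$ in the following construction. For $n\ge 1$ let $\wp_n:\mathbf{C}_a\to\mathbb{R}^{2^n}$, $\wp_n x=\big(x(\tfrac{a}{2^n}),\ x(\tfrac{2a}{2^n})-x(\tfrac{a}{2^n}),\ldots,x(\tfrac{a2^n}{2^n})-x(\tfrac{a(2^n-1)}{2^n})\big)$; let $\nu_n$ be the joint law on $\mathbb{R}^{2^n}$ of $2^n$ independent normal variables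 with mean $0$ and variance $a/2^n$; let $\alpha_n(\wp_n^{-1}(B))=\nu_n(B)$ for Borel $B\subset\mathbb{R}^{2^n}$; for compact $K\subset\mathbf{C}_a$ let $\varphi(K)=\lim_{n\to\infty}\alpha_n(\wp_n^{-1}\wp_n(K))$; and for $A\in\mathfrak{C}_a$ let $\mu(A)=\sup\{\varphi(K):K\subset A,\ K\text{ compact}\}$. The sequence $\mu_r(Q_rK)$, $r\ge1$, is non-increasing for compact $K\subset\mathbf{C}_\infty$, so the limit defining $\mu_\infty(K)$ exists. *)

(* Defs.v *)
From HB Require Import structures.
From mathcomp Require Import all_boot all_order all_algebra.
From mathcomp Require Import all_classical all_reals all_analysis.
From mathcomp Require Import lra.

Set Implicit Arguments.
Unset Strict Implicit.
Unset Printing Implicit Defensive.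

Import Order.TTheory GRing.Theory Num.Theory.
Import numFieldNormedType.Exports.

Local Open Scope classical_set_scope.
Local Open Scope ring_scope.

(* A continuous function on [I] vanishing at 0 is represented by its extension
   by zero to the whole of [R], so that Leibniz equality of paths is equality
   of the functions on [I]. *)
Record path_on (R : realType) (I : set R) := PathOn {
  path_fun :> R -> R ;
  path_continuous : {within I, continuous path_fun} ;
  path_at0 : path_fun 0 = 0 ;
  path_out : forall t, ~ I t -> path_fun t = 0
}.

Section path_on.
Context {R : realType} {I : set R}.

Lemma path_onP (f g : path_on I) : (forall t, I t -> f t = g t) -> f = g.
Proof.
move=> fg; have {fg} : path_fun f = path_fun g.
  apply/funext => t; have [/fg//|nIt] := pselect (I t).
  by rewrite !path_out.
case: f g => [f cf f0 fo] [g cg g0 go] /= fg; subst g.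
by congr PathOn; exact: Prop_irrelevance.
Qed.

Lemma zero_path_continuous : {within I, continuous (fun=> 0 : R)}.
Proof. by move=> ?; exact: cvg_cst. Qed.

Definition zero_path : path_on I :=
  PathOn zero_path_continuous erefl (fun _ _ => erefl).

Section restriction.
Variables (J : set R) (JI : J `<=` I) (f : path_on I).

Lemma restr_path_continuous : {within J, continuous (patch (fun=> 0) J f)}.
Proof.
apply: (@subspace_eq_continuous _ J _ f) => [t tJ|].
  by rewrite /from_subspace /patch tJ.
by apply: (continuous_subspaceW JI); exact: path_continuous.
Qed.

Lemma restr_path_at0 : patch (fun=> 0) J f 0 = 0.
Proof. by rewrite /patch path_at0; case: ifP. Qed.

Lemma restr_path_out t : ~ J t -> patch (fun=> 0) J f t = 0.
Proof. by move=> Jt; rewrite /patch memNset. Qed.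

Definition restr_path : path_on J :=
  PathOn restr_path_continuous restr_path_at0 restr_path_out.

End restriction.
End path_on.

Section sup_distance.
Context {R : realType}.
Implicit Types (a : R) (f g h : R -> R).

Definition sup_dist a f g : R := sup [set `|f t - g t| | t in `[0, a]].

Lemma sup_dist_has_ubound a f g :
  {within `[0, a], continuous f} -> {within `[0, a], continuous g} ->
  has_ubound [set `|f t - g t| | t in `[0, a]].
Proof.
move=> cf cg; have [a0|a0] := leP 0 a; last first.
  exists 0 => _ [t /= + <-]; rewrite in_itv/= => /andP[t0 ta].
  by have := le_lt_trans (le_trans t0 ta) a0; rewrite ltxx.
have cfg : {within `[0, a], continuous (fun t => `|f t - g t|)}.
  move=> t; apply: (@cvg_norm _ R).
  by apply: (@cvgB _ R); [exact: cf|exact: cg].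
have [c _ cmax] := EVT_max a0 cfg.
by exists `|f c - g c| => _ [t /= ta <-]; exact: cmax.
Qed.

Lemma sup_dist_ge0 a f g : 0 <= sup_dist a f g.
Proof.
rewrite /sup_dist; set E := [set _ | _ in _].
have [E0|/set0P[_ [t ta _]]] := eqVneq E set0; first by rewrite E0 sup0.
have [ub|nub] := pselect (has_ubound E); last by rewrite sup_out// => -[].
by apply: (le_trans (normr_ge0 (f t - g t))); apply: ub_le_sup => //; exists t.
Qed.

Lemma sup_dist_ub a f g t :
  {within `[0, a], continuous f} -> {within `[0, a], continuous g} ->
  0 <= t <= a -> `|f t - g t| <= sup_dist a f g.
Proof.
move=> cf cg ta; apply: ub_le_sup; first exact: sup_dist_has_ubound.
by exists t => //=; rewrite in_itv.
Qed.

Lemma sup_dist_le a f g M : 0 <= M ->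
  (forall t, 0 <= t <= a -> `|f t - g t| <= M) -> sup_dist a f g <= M.
Proof.
move=> M0 fgM; rewrite /sup_dist; set E := [set _ | _ in _].
have [E0|/set0P ne] := eqVneq E set0; first by rewrite E0 sup0.
by apply: ge_sup => // _ [t /= + <-]; rewrite in_itv/=; exact: fgM.
Qed.

Lemma sup_distxx a f : sup_dist a f f = 0.
Proof.
apply/eqP; rewrite eq_le sup_dist_ge0 andbT; apply: sup_dist_le => // t _.
by rewrite subrr normr0.
Qed.

Lemma sup_dist_sym a f g : sup_dist a f g = sup_dist a g f.
Proof. by congr sup; apply: eq_imagel => t _; rewrite distrC. Qed.

Lemma sup_dist_triangle a f g h :
  {within `[0, a], continuous f} -> {within `[0, a], continuous g} ->
  {within `[0, a], continuous h} ->
  sup_dist a f h <= sup_dist a f g + sup_dist a g h.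
Proof.
move=> cf cg ch; apply: sup_dist_le => [|t ta].
  by rewrite addr_ge0// sup_dist_ge0.
rewrite (le_trans (ler_distD (g t) _ _))//.
by apply: lerD; apply: sup_dist_ub.
Qed.

End sup_distance.

Definition Cpath (R : realType) (a : R) : Type := path_on `[0, a].

HB.instance Definition _ (R : realType) (a : R) := gen_eqMixin (Cpath a).
HB.instance Definition _ (R : realType) (a : R) := gen_choiceMixin (Cpath a).
HB.instance Definition _ (R : realType) (a : R) :=
  isPointed.Build (Cpath a) zero_path.

Section Cpath_metric.
Context {R : realType} (a : R).
Implicit Types f g h : Cpath a.

Let dist f g : R := sup_dist a f g.

Let distxx f : dist f f = 0. Proof. exact: sup_distxx. Qed.

Let dist_positivity f g : dist f g = 0 -> f = g.
Proof.
move=> fg0; apply: path_onP => t; rewrite /= in_itv/= => ta.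
apply/eqP; rewrite -subr_eq0 -normr_le0.
apply: (@le_trans _ _ (dist f g)); last by rewrite fg0.
by apply: sup_dist_ub ta; exact: path_continuous.
Qed.

Let dist_sym f g : dist f g = dist g f. Proof. exact: sup_dist_sym. Qed.

Let dist_triangle g f h : dist f h <= dist f g + dist g h.
Proof. by apply: sup_dist_triangle; exact: path_continuous. Qed.

HB.instance Definition _ := isMetric.Build R (Cpath a)
  distxx dist_positivity dist_sym dist_triangle.

End Cpath_metric.

Definition Cinfty (R : realType) : Type := path_on (`[0, +oo[ : set R).

HB.instance Definition _ (R : realType) := gen_eqMixin (Cinfty R).
HB.instance Definition _ (R : realType) := gen_choiceMixin (Cinfty R).
HB.instance Definition _ (R : realType) := isPointed.Build (Cinfty R) zero_path.

Definition Cinfty_dist (R : realType) (f g : Cinfty R) : R :=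
  limn (fun N => \sum_(1 <= n < N)
    2^-1 ^+ n * (sup_dist n%:R f g / (1 + sup_dist n%:R f g))).

Section Cinfty_metric.
Context {R : realType}.
Implicit Types f g h : Cinfty R.

Lemma Cinfty_continuous f a : {within `[0, a], continuous f}.
Proof.
apply: continuous_subspaceW (@path_continuous _ _ f) => t /=.
by rewrite !in_itv/= => /andP[->].
Qed.

Let term f g (n : nat) : R :=
  2^-1 ^+ n * (sup_dist n%:R f g / (1 + sup_dist n%:R f g)).

Let half_ge0 n : (0 : R) <= 2^-1 ^+ n.
Proof. by rewrite exprn_ge0// invr_ge0. Qed.

Let term_ge0 f g n : 0 <= term f g n.
Proof.
by rewrite mulr_ge0// divr_ge0 ?sup_dist_ge0// addr_ge0// sup_dist_ge0.
Qed.

Let term_le f g n : term f g n <= 2^-1 ^+ n.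
Proof.
have s0 := sup_dist_ge0 n%:R f g.
rewrite ler_piMr// ler_pdivrMr ?mul1r ?lerDr//.
by rewrite ltr_pwDl.
Qed.

Let term_sym f g n : term f g n = term g f n.
Proof. by rewrite /term sup_dist_sym. Qed.

Let frac_le (x y z : R) : 0 <= x -> 0 <= y -> 0 <= z -> x <= y + z ->
  x / (1 + x) <= y / (1 + y) + z / (1 + z).
Proof.
move=> x0 y0 z0 xyz.
have x1 : 0 < 1 + x by rewrite ltr_pwDl.
have y1 : 0 < 1 + y by rewrite ltr_pwDl.
have z1 : 0 < 1 + z by rewrite ltr_pwDl.
have yz1 : 0 < 1 + (y + z) by rewrite ltr_pwDl// addr_ge0.
apply: (@le_trans _ _ ((y + z) / (1 + (y + z)))).
  rewrite ler_pdivrMr// mulrAC ler_pdivlMr//.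
  lra.
rewrite mulrDl; apply: lerD; apply: ler_wpM2l => //.
  by rewrite lef_pV2 ?posrE// addrA lerDl.
by rewrite lef_pV2 ?posrE// addrCA lerDr.
Qed.

Let term_triangle g f h n : term f h n <= term f g n + term g h n.
Proof.
rewrite /term -mulrDr ler_wpM2l// frac_le ?sup_dist_ge0//.
by apply: sup_dist_triangle; exact: Cinfty_continuous.
Qed.

Let psum f g n : R := \sum_(1 <= k < n) term f g k.

Let psum_nd f g : nondecreasing_seq (psum f g).
Proof.
apply/nondecreasing_seqP => -[|n]; first by rewrite /psum !big_geq.
by rewrite {2}/psum big_nat_recr//= lerDl.
Qed.

Let half_sum n : \sum_(1 <= k < n.+1) (2^-1 ^+ k : R) = 1 - 2^-1 ^+ n.
Proof.
elim: n => [|n ih]; first by rewrite big_geq// expr0 subrr.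
by rewrite big_nat_recr//= ih exprS; lra.
Qed.

Let psum_le1 f g n : psum f g n <= 1.
Proof.
case: n => [|n]; first by rewrite /psum big_geq.
rewrite /psum (@le_trans _ _ (1 - 2^-1 ^+ n))// ?gerBl//.
by rewrite -half_sum ler_sum.
Qed.

Let cvg_psum f g : cvgn (psum f g).
Proof.
apply: nondecreasing_is_cvgn; first exact: psum_nd.
by exists 1 => _ [n _ <-]; exact: psum_le1.
Qed.

Let distE f g : Cinfty_dist f g = limn (psum f g).
Proof. by []. Qed.

Let distxx f : Cinfty_dist f f = 0.
Proof.
rewrite distE (_ : psum f f = fun=> 0) ?lim_cst//.
apply/funext => n; rewrite /psum big1// => k _.
by rewrite /term sup_distxx mul0r mulr0.
Qed.

Let term_le_dist f g n : (0 < n)%N -> term f g n <= Cinfty_dist f g.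
Proof.
move=> n0; rewrite distE.
apply: (@le_trans _ _ (psum f g n.+1)).
  by rewrite /psum big_nat_recr//= lerDr sumr_ge0.
by apply: nondecreasing_cvgn_le; [exact: psum_nd|exact: cvg_psum].
Qed.

Let dist_positivity f g : Cinfty_dist f g = 0 -> f = g.
Proof.
move=> fg0; apply: path_onP => t; rewrite /= in_itv/= andbT => t0.
have [n tn] : exists n, t <= n.+1%:R.
  exists (Num.truncn t); apply/ltW; exact: truncnS_gt.
have tn0 : term f g n.+1 = 0.
  by apply/eqP; rewrite eq_le term_ge0 andbT -fg0 term_le_dist.
have s0 := sup_dist_ge0 n.+1%:R f g.
have {tn0} /eqP : sup_dist n.+1%:R f g = 0.
  move/eqP: tn0; rewrite /term !mulf_eq0 expf_eq0/= !invr_eq0.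
  rewrite (_ : (2 : R) == 0 = false) ?pnatr_eq0//= => /orP[/eqP//|].
  by rewrite gt_eqF// ltr_pwDl.
rewrite eq_le => /andP[s1 _]; apply/eqP; rewrite -subr_eq0 -normr_le0.
apply: le_trans s1; apply: sup_dist_ub; try exact: Cinfty_continuous.
by rewrite t0 tn.
Qed.

Let dist_sym f g : Cinfty_dist f g = Cinfty_dist g f.
Proof.
rewrite !distE; congr (limn _); apply/funext => n.
by apply: eq_bigr => k _; exact: term_sym.
Qed.

Let dist_triangle g f h : Cinfty_dist f h <= Cinfty_dist f g + Cinfty_dist g h.
Proof.
rewrite !distE -limD//; apply: ler_lim; first exact: cvg_psum.
  by apply: is_cvgD.
apply: nearW => n.
rewrite [leRHS](_ : _ = psum f g n + psum g h n)// /psum -big_split/=.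
by apply: ler_sum => k _; exact: term_triangle.
Qed.

HB.instance Definition _ := isMetric.Build R (Cinfty R)
  distxx dist_positivity dist_sym dist_triangle.

End Cinfty_metric.

Definition borel (T : ptopologicalType) := g_sigma_algebraType (@open T).

Lemma segment_sub_halfline (R : realType) (a : R) : `[0, a] `<=` `[0, +oo[.
Proof. by move=> t /=; rewrite !in_itv/= => /andP[->]. Qed.

Definition Qrestr (R : realType) (r : nat) (f : Cinfty R) : Cpath (r%:R : R) :=
  restr_path (@segment_sub_halfline R r%:R) f.

Section normal_law.
Context {R : realType}.

Local Notation RR := (measurableTypeR R).

Definition cons_pair N (p : RR * N.-tuple RR) : N.+1.-tuple RR :=
  [tuple of p.1 :: p.2].

Lemma measurable_cons_pair N : measurable_fun setT (@cons_pair N).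
Proof. by apply: measurable_cons. Qed.

HB.instance Definition _ N :=
  isMeasurableFun.Build _ _ _ _ (@cons_pair N) (@measurable_cons_pair N).

Lemma prod_probability_setT d1 d2 (T1 : measurableType d1)
    (T2 : measurableType d2) (P1 : probability T1 R) (P2 : probability T2 R) :
  (P1 \x P2)%E [set: T1 * T2] = 1%E.
Proof.
rewrite -setXTT [LHS]product_measure1E// -[RHS]mule1.
by congr (_ * _)%E; exact: probability_setT.
Qed.

Definition prod_probability d1 d2 (T1 : measurableType d1)
    (T2 : measurableType d2) (P1 : probability T1 R) (P2 : probability T2 R) :=
  (P1 \x P2)%E.

HB.instance Definition _ d1 d2 (T1 : measurableType d1)
    (T2 : measurableType d2) (P1 : probability T1 R) (P2 : probability T2 R) :=
  Measure.on (prod_probability P1 P2).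

HB.instance Definition _ d1 d2 (T1 : measurableType d1)
    (T2 : measurableType d2) (P1 : probability T1 R) (P2 : probability T2 R) :=
  Measure_isProbability.Build _ _ _ (prod_probability P1 P2)
    (prod_probability_setT P1 P2).

(* Joint law of [N] independent normal variables with mean 0 and standard
   deviation [s], i.e. the [N]-fold product of [normal_prob 0 s]. *)
Fixpoint iid_normal (s : R) (N : nat) : probability (N.-tuple RR) R :=
  match N with
  | 0 => \d_ ([tuple] : 0.-tuple RR)
  | M.+1 => distribution
      (prod_probability (normal_prob 0 s) (iid_normal s M)) (@cons_pair M)
  end.

Lemma iid_normal_box (s : R) N (B : 'I_N -> set RR) :
  (forall i, measurable (B i)) ->
  iid_normal s N [set v | forall i, B i (tnth v i)] =
  (\prod_(i < N) normal_prob 0 s (B i))%E.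
Proof.
elim: N B => [|N ih] B mB.
  by rewrite big_ord0 /= diracE mem_set//= => -[].
rewrite big_ord_recl -ih//.
have mbox : measurable [set v : N.-tuple RR | forall i, B (lift ord0 i) (tnth v i)].
  rewrite (_ : [set v | _] =
      \big[setI/setT]_(i < N) ((@tnth N RR)^~ i @^-1` B (lift ord0 i))).
    apply: bigsetI_measurable => i _.
    by rewrite -[X in measurable X]setTI; exact: measurable_tnth.
  rewrite -bigcap_seq; apply/seteqP; split => [v Bv i _|v Bv i]; first exact: Bv.
  by apply: Bv => /=; rewrite mem_index_enum.
rewrite -[RHS](@product_measure1E _ _ _ _ _ (normal_prob 0 s) (iid_normal s N))//.
rewrite /= /distribution /pushforward /prod_probability; congr (_ _).
apply/seteqP; split => [[x v] /= Bxv|[x v] [/= Bx Bv] i].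
  split => /= [|i]; first exact: (Bxv ord0).
  by have := Bxv (lift ord0 i); rewrite /cons_pair tnthS.
case: (unliftP ord0 i) => [j|] ->; rewrite /cons_pair; last exact: Bx.
by rewrite tnthS; exact: Bv.
Qed.

End normal_law.

Section wiener.
Context {R : realType} (a : R).
Local Notation RR := (measurableTypeR R).

Definition increments (n : nat) (x : Cpath a) : (2 ^ n).-tuple RR :=
  [tuple x (a * i.+1%:R / 2 ^+ n) - x (a * i%:R / 2 ^+ n) | i < 2 ^ n].

Definition nu (n : nat) : probability ((2 ^ n).-tuple RR) R :=
  iid_normal (Num.sqrt (a / 2 ^+ n)) (2 ^ n).

(* Meant for cylinders [increments n @^-1` B], on which it is [nu n B], as
   [increments n] is onto; see [alpha_preimage]. *)
Definition alpha (n : nat) (A : set (Cpath a)) : \bar R :=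
  nu n (increments n @` A).

Definition phi (K : set (Cpath a)) : \bar R :=
  limn (fun n => alpha n (increments n @^-1` (increments n @` K))).

Definition wiener (A : set (Cpath a)) : \bar R :=
  ereal_sup [set phi K | K in [set K | compact K /\ K `<=` A]].

Section increments_onto.
Hypothesis a_gt0 : 0 < a.
Variables (n : nat) (c : (2 ^ n).-tuple RR).

Let clamp (u : R) : R := Num.max 0 (Num.min 1 u).

Let interp (t : R) : R :=
  \sum_(i < 2 ^ n) tnth c i * clamp (t * (2 ^+ n / a) - i%:R).

Let clamp_int (k i : nat) : clamp (k%:R - i%:R) = (i < k)%:R.
Proof.
rewrite /clamp; have [ik|ki] := ltnP i k.
  rewrite min_l ?max_r//.
  by rewrite -natrB ?(ltnW ik)// ler1n subn_gt0.
rewrite max_l// ge_min; apply/orP; right.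
by rewrite subr_le0 ler_nat.
Qed.

Let interp_node (k : nat) : interp (a * k%:R / 2 ^+ n) =
  \sum_(i < 2 ^ n) tnth c i * (i < k)%:R.
Proof.
apply: eq_bigr => i _; rewrite -clamp_int; congr (_ * clamp (_ - _)).
by rewrite mulrA divfK ?expf_neq0 ?pnatr_eq0// mulrAC divff ?mul1r// gt_eqF.
Qed.

Let interp_continuous : continuous interp.
Proof.
apply: continuous_big => [|i _ t]; first exact: add_continuous.
apply: cvgM; first exact: cvg_cst.
apply: (@continuous_comp R R R (fun t => t * (2 ^+ n / a) - i%:R) clamp t).
  apply: cvgB; last exact: cvg_cst.
  by apply: cvgM; [exact: cvg_id|exact: cvg_cst].
apply: (@continuous_max R R (fun=> 0)); first exact: cvg_cst.
by apply: (@continuous_min R R (fun=> 1)); [exact: cvg_cst|exact: cvg_id].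
Qed.

Let interp0 : interp 0 = 0.
Proof.
have := interp_node 0; rewrite mulr0 mul0r => ->.
by rewrite big1// => i _; rewrite mulr0.
Qed.

Let interp_path : path_on setT :=
  PathOn (continuous_subspaceT interp_continuous) interp0
    (fun t (nt : ~ setT t) => False_ind _ (nt I)).

Lemma increments_onto : exists x : Cpath a, increments n x = c.
Proof.
exists (restr_path (@subsetT _ _) interp_path).
have node (k : nat) : (k <= 2 ^ n)%N ->
    restr_path (@subsetT _ `[0, a]) interp_path (a * k%:R / 2 ^+ n) =
    \sum_(i < 2 ^ n) tnth c i * (i < k)%:R.
  move=> kn; rewrite -interp_node /= /patch mem_set//= in_itv/=.
  have p0 : 0 < 2 ^+ n :> R by rewrite exprn_gt0.
  rewrite (divr_ge0 (mulr_ge0 (ltW a_gt0) (ler0n _ k)) (ltW p0))/=.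
  by rewrite ler_pdivrMr// ler_pM2l// -natrX ler_nat.
apply: eq_from_tnth => k; rewrite tnth_mktuple.
rewrite !node ?(ltnW (ltn_ord k))// -sumrB (bigD1 k)//= big1 ?addr0.
  by rewrite ltnSn ltnn mulr1 mulr0 subr0.
move=> i ik; rewrite -mulrBr ltnS leq_eqVlt (_ : (i == k :> nat) = false).
  by rewrite subrr mulr0.
exact: negbTE.
Qed.

End increments_onto.

Lemma alpha_preimage (n : nat) (B : set ((2 ^ n).-tuple RR)) : 0 < a ->
  alpha n (increments n @^-1` B) = nu n B.
Proof.
move=> a0; rewrite /alpha image_preimage// eqEsubset; split=> // c _.
by have [x xc] := increments_onto a0 c; exists x.
Qed.

End wiener.

(* The degenerate index [r = 0] does not affect the limit. *)
Definition wiener_infty_compact (R : realType) (K : set (Cinfty R)) : \bar R :=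
  limn (fun r => wiener (@Qrestr R r @` K)).

Definition wiener_infty (R : realType) (A : set (Cinfty R)) : \bar R :=
  ereal_sup [set wiener_infty_compact K | K in [set K | compact K /\ K `<=` A]].

(* Main.v *)
From HB Require Import structures.
Require Import Defs.
From mathcomp Require Import all_boot all_order all_algebra.
From mathcomp Require Import all_classical all_reals all_analysis.
From mathcomp Require Import measurable_realfun.
From mathcomp Require Import lra ring.

Set Implicit Arguments.
Unset Strict Implicit.
Unset Printing Implicit Defensive.

Import Order.TTheory GRing.Theory Num.Theory.
Import numFieldNormedType.Exports.

Local Open Scope classical_set_scope.
Local Open Scope ring_scope.

(** The increments of Brownian motion over the intervals of length 2^-n in
    [0, 2^n] are 4^n independent N(0, 2^-n) variables. As sums of independent
    normal variables are normal, these laws are consistent and define a content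
    on the cylinders of C_infty. By a union bound, the paths whose increments of
    every dyadic level m are at most C (9/10)^m form a set whose content is
    close to 1 when C is large, and chaining makes this set compact. This
    tightness yields countable additivity of the content, hence a measure P by
    Caratheodory's extension. A compact set is a countable intersection of
    cylinders, and a closed set is, up to a null set, a countable union of
    compact sets, so that all Borel sets are measurable for the extension.

    For r an integer, the nodes r k / 2^n are dyadic, so the law of the
    increments of Q_r f under P is nu_n. A compact K is the decreasing
    intersection of the sets Q_r^-1 (Q_r K), and Q_r^-1 (Q_r K) is that of
    the cylinders wp_n^-1 (wp_n (Q_r K)): two limits from above identify P K
    with the limit of the mu_r (Q_r K). Finally P is inner regular with respect
    to compact sets, because it is tight and Borel sets of a metric space are
    approximated from inside by closed sets. *)

(** * Normal laws *)

Section normal_law.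
Context {R : realType}.
Local Notation RR := (measurableTypeR R).
Local Notation mu := (@lebesgue_measure R).
Implicit Types (m s x y z : R) (h : RR -> \bar R).

(** The Radon-Nikodym derivative of the law is almost everywhere its density, since both have the
    same integral over every measurable set. *)
Lemma integral_normal_prob m s h : measurable_fun [set: RR] h ->
  (forall x, 0 <= h x)%E ->
  (\int[normal_prob m s]_x h x = \int[mu]_x (h x * (normal_pdf m s x)%:E))%E.
Proof.
move=> mh h0.
have dom : normal_prob m s `<< mu := normal_prob_dominates m s.
rewrite -(Radon_Nikodym_SigmaFinite.change_of_variables dom)//.
have mg : measurable_fun [set: R] (EFin \o normal_pdf m s).
  by apply/measurable_EFinP; exact: measurable_normal_pdf.
have ig := Radon_Nikodym_SigmaFinite.f_integrable dom.
have mf := measurable_int _ ig.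
apply: ae_eq_integral => //.
- exact: emeasurable_funM.
- exact: emeasurable_funM.
have : ae_eq mu setT (Radon_Nikodym_SigmaFinite.f (normal_prob m s) mu)
    (EFin \o normal_pdf m s).
  apply: integral_ae_eq => // E _ mE.
  by rewrite -(Radon_Nikodym_SigmaFinite.f_integral dom).
by apply: filterS => x /= /(_ I) ->.
Qed.

(* Completing the square: given the sum, a summand is again normal. *)
Lemma normal_pdf_conv m s1 s2 y z : 0 < s1 -> 0 < s2 ->
  normal_pdf (m + y) s1 z * normal_pdf 0 s2 y =
  normal_pdf m (Num.sqrt (s1 ^+ 2 + s2 ^+ 2)) z *
  normal_pdf ((z - m) * s2 ^+ 2 / (s1 ^+ 2 + s2 ^+ 2))
    (s1 * s2 / Num.sqrt (s1 ^+ 2 + s2 ^+ 2)) y.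
Proof.
move=> s10 s20; set s := Num.sqrt _.
have ss : s ^+ 2 = s1 ^+ 2 + s2 ^+ 2.
  by rewrite sqr_sqrtr// addr_ge0// sqr_ge0.
have s0 : 0 < s by rewrite sqrtr_gt0 ltr_pwDl// ?exprn_gt0// sqr_ge0.
have s'0 : 0 < s1 * s2 / s by rewrite divr_gt0// mulr_gt0.
rewrite !normal_pdfE ?gt_eqF//.
rewrite mulrACA [RHS]mulrACA; congr (_ * _).
  rewrite /normal_peak -!invfM -!sqrtrM; first last.
  - by rewrite pmulrn_lge0// mulr_ge0 ?sqr_ge0 ?pi_ge0.
  - by rewrite pmulrn_lge0// mulr_ge0 ?sqr_ge0 ?pi_ge0.
  congr (_^-1); congr Num.sqrt.
  rewrite !mulr2n exprMn exprVn exprMn.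
  set p := pi; have : s ^+ 2 != 0 by rewrite gt_eqF ?exprn_gt0.
  move: (s1 ^+ 2) (s2 ^+ 2) (s ^+ 2) p => a b c p c0.
  by field.
rewrite /normal_fun -!expRD; congr expR; rewrite -ss.
rewrite !mulr2n exprMn exprVn exprMn ss.
have : s1 ^+ 2 + s2 ^+ 2 != 0 by rewrite -ss gt_eqF ?exprn_gt0.
have : s1 ^+ 2 != 0 by rewrite gt_eqF ?exprn_gt0.
have : s2 ^+ 2 != 0 by rewrite gt_eqF ?exprn_gt0.
move: (s1 ^+ 2) (s2 ^+ 2) => a b b0 a0 ab0.
by field; rewrite -!mulr2n !mulrn_eq0/= mulf_eq0 !negb_or a0 b0 ab0.
Qed.

(** Tonelli moves the integral over [y] inside, where by [normal_pdf_conv] it becomes that of a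
    normal density, that is 1. With [h] an indicator, this is the law of a sum of independent normal
    variables. *)
Lemma integral_normal_conv m s1 s2 h : 0 < s1 -> 0 < s2 ->
  measurable_fun [set: RR] h -> (forall x, 0 <= h x)%E ->
  (\int[normal_prob 0 s2]_y \int[normal_prob (m + y) s1]_z h z =
   \int[normal_prob m (Num.sqrt (s1 ^+ 2 + s2 ^+ 2))]_z h z)%E.
Proof.
move=> s10 s20 mh h0.
pose G (p : RR * RR) := (h p.2 * (normal_pdf (m + p.1) s1 p.2)%:E)%E.
have mpdf : measurable_fun setT
    (fun p : RR * RR => normal_pdf (m + p.1) s1 p.2).
  (* Shifting the centre amounts to shifting the argument, which makes the density jointly
     measurable. *)
  rewrite (_ : (fun _ => _) = fun p => normal_pdf m s1 (p.2 - p.1)).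
    apply: (measurableT_comp (measurable_normal_pdf m s1)).
    exact: measurable_funB.
  apply/funext => p; rewrite !normal_pdfE ?gt_eqF//; congr (_ * expR _).
  by rewrite opprD addrCA addrC.
have mhp : measurable_fun setT (fun p : RR * RR => h p.2).
  exact: measurableT_comp.
have mG : measurable_fun setT G.
  by apply: emeasurable_funM => //; exact/measurable_EFinP.
have G0 p : (0 <= G p)%E by rewrite mule_ge0// lee_fin normal_pdf_ge0.
transitivity (\int[normal_prob 0 s2]_y \int[mu]_z G (y, z))%E.
  by apply: eq_integral => y _; rewrite integral_normal_prob.
rewrite integral_normal_prob; first last.
- by move=> y; exact: integral_ge0.
- exact: (measurable_fun_fubini_tonelli_F (m2 := mu) G).
rewrite [RHS](integral_normal_prob _ _ mh h0).
pose H (p : RR * RR) := (G p * (normal_pdf 0 s2 p.1)%:E)%E.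
have mH : measurable_fun setT H.
  apply: emeasurable_funM => //; apply/measurable_EFinP.
  exact: (measurableT_comp (measurable_normal_pdf 0 s2)).
have H0 p : (0 <= H p)%E by rewrite mule_ge0// lee_fin normal_pdf_ge0.
transitivity (\int[mu]_y \int[mu]_z H (y, z))%E.
  apply: eq_integral => y _.
  rewrite -ge0_integralZr//; last by rewrite lee_fin normal_pdf_ge0.
  by apply: (measurableT_comp mG); exact: pair1_measurable.
rewrite fubini_tonelli//; apply: eq_integral => z _.
rewrite /H /G/=.
under eq_integral.
  move=> y _; rewrite -muleA -EFinM normal_pdf_conv// EFinM muleA; over.
rewrite ge0_integralZl//.
- by rewrite integral_normal_pdf mule1.
- by apply/measurable_EFinP; exact: measurable_normal_pdf.
- by move=> y _; rewrite lee_fin normal_pdf_ge0.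
- by rewrite mule_ge0// lee_fin normal_pdf_ge0.
Qed.

Lemma measurable_norm_gt (d : R) : measurable [set y : RR | d < `|y|].
Proof.
rewrite [X in measurable X](_ : _ = (fun y : R => `|y|) @^-1` [set z | d < z])//.
apply: open_measurable; apply: open_comp; last exact: open_gt.
by move=> y _; exact: norm_continuous.
Qed.

(* The density is bounded on the tail by a multiple of the normal density with
   doubled variance, so only its normalisation is needed. *)
Lemma normal_prob_tail s (d : R) (k : nat) : 0 < s -> 0 < d ->
  (normal_prob 0 s [set y | (d < `|y|)%R] <=
   (2 * k.+1`!%:R * (4 * s ^+ 2 / d ^+ 2) ^+ k.+1)%:E)%E.
Proof.
move=> s0 d0.
have r20 : 0 < Num.sqrt (2 : R) by rewrite sqrtr_gt0.
have r2s : 0 < Num.sqrt 2 * s by rewrite mulr_gt0.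
have r22 : Num.sqrt 2 ^+ 2 = 2 :> R by rewrite sqr_sqrtr.
(* The exponent [y ^+ 2 / (2 * s ^+ 2)] is halved: for |y| > d one half is at least [u], the other
   is the exponent for variance [2 * s ^+ 2]. The ratio of the peaks, the root of 2, is finally
   rounded up to 2. *)
set u := d ^+ 2 / (4 * s ^+ 2).
have u0 : 0 < u by rewrite divr_gt0 ?mulr_gt0 ?exprn_gt0.
have -> : 4 * s ^+ 2 / d ^+ 2 = u^-1 by rewrite /u invf_div.
(* A single term of the exponential series bounds [expR u] from below. *)
have expu : expR (- u) <= k.+1`!%:R * u^-1 ^+ k.+1.
  rewrite expRN exprVn -[leRHS]invrK lef_pV2 ?posrE ?expR_gt0//; last first.
    by rewrite invr_gt0 mulr_gt0 ?ltr0n ?fact_gt0// invr_gt0 exprn_gt0.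
  apply: le_trans (expR_ge1Dxn k (ltW u0)).
  by rewrite invfM invrK mulrC lerDr.
set c := Num.sqrt 2 * (k.+1`!%:R * u^-1 ^+ k.+1).
have fac0 : 0 <= k.+1`!%:R * u^-1 ^+ k.+1 :> R.
  by rewrite mulr_ge0// exprn_ge0// invr_ge0 ltW.
have c0 : 0 <= c by rewrite mulr_ge0// ltW.
have mA : measurable [set y : R | d < `|y|] by exact: measurable_norm_gt.
rewrite /normal_prob.
apply: (@le_trans _ _ (\int[mu]_(x in [set y | (d < `|y|)%R])
  (c%:E * (normal_pdf 0 (Num.sqrt 2 * s) x)%:E))%E).
  apply: ge0_le_integral => //.
  - by move=> x _; rewrite lee_fin normal_pdf_ge0.
  - by apply/measurable_EFinP/measurable_funTS; exact: measurable_normal_pdf.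
  - apply/measurable_EFinP/measurable_funTS; apply: measurable_funM => //.
    exact: measurable_normal_pdf.
  move=> y /= dy; rewrite -EFinM lee_fin !normal_pdfE ?gt_eqF//.
  have -> : normal_peak s = Num.sqrt 2 * normal_peak (Num.sqrt 2 * s).
    rewrite /normal_peak exprMn r22.
    have -> : 2 * s ^+ 2 * pi *+ 2 = 2 * (s ^+ 2 * pi *+ 2) :> R.
      by rewrite mulrnAr mulrA.
    by rewrite (sqrtrM (s ^+ 2 * pi *+ 2))// invfM mulVKf// gt_eqF.
  rewrite /c -!mulrA ler_pM2l// [leRHS](_ : _ = normal_peak (Num.sqrt 2 * s) *
    (k.+1`!%:R * u^-1 ^+ k.+1 * normal_fun 0 (Num.sqrt 2 * s) y)); last by ring.
  rewrite ler_pM2l ?normal_peak_gt0 ?gt_eqF//.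
  apply: le_trans (ler_wpM2r (normal_fun_ge0 _ _ _) expu).
  rewrite /normal_fun -expRD ler_expR subr0 exprMn r22.
  have d2y2 : d ^+ 2 <= y ^+ 2.
    by rewrite -(real_normK (num_real y))// lerXn2r ?nnegrE// ltW.
  have -> : - y ^+ 2 / (2 * s ^+ 2 *+ 2) = - (y ^+ 2 / (4 * s ^+ 2)).
    by field; rewrite gt_eqF.
  have -> : - y ^+ 2 / (s ^+ 2 *+ 2) =
      - (y ^+ 2 / (4 * s ^+ 2)) - (y ^+ 2 / (4 * s ^+ 2)).
    by field; rewrite gt_eqF.
  rewrite lerD2r lerN2 /u ler_pM2r// invr_gt0 mulr_gt0// exprn_gt0//.
have mpdf : measurable_fun [set: R]
    (fun x => (normal_pdf 0 (Num.sqrt 2 * s) x)%:E).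
  by apply/measurable_EFinP; exact: measurable_normal_pdf.
rewrite ge0_integralZl//; first last.
- by move=> y _; rewrite lee_fin normal_pdf_ge0.
- exact: measurable_funTS.
have := @probability_le1 _ _ _ (normal_prob 0 (Num.sqrt 2 * s) : probability RR R)
   [set y : R | d < `|y|] mA.
rewrite /normal_prob => p1.
apply: le_trans (lee_wpmul2l _ p1) _; first by rewrite lee_fin.
rewrite mule1 lee_fin /c -mulrA ler_wpM2r//.
rewrite -(ler_pXn2r (n := 2)) ?nnegrE ?(ltW r20)// r22; lra.
Qed.

End normal_law.

(** * Sums over consecutive blocks of independent normal variables *)

Section iid_normal_blocks.
Context {R : realType}.
Local Notation RR := (measurableTypeR R).
Local Notation mu := (@lebesgue_measure R).
Implicit Types (m s x y z : R) (h : RR -> \bar R).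

Lemma lebesgue_measure_translation x (A : set RR) : measurable A ->
  pushforward mu (fun y : RR => x + y : RR) A = mu A.
Proof.
move=> mA.
have mx : measurable_fun setT (fun y : RR => x + y : RR).
  exact: measurable_funD.
apply/esym/(@lebesgue_measure_unique R
  (pushforward mu (fun y : RR => x + y : RR))) => //= _ [[a b]] _ <-.
rewrite /pushforward (_ : _ @^-1` _ = `](a - x), (b - x)]%classic); last first.
  by apply/seteqP; split => y /=; rewrite !in_itv/= ltrBlDl lerBrDl.
rewrite !lebesgue_measure_itv/= !lte_fin ltrBlDr subrK.
by rewrite -!EFinB opprB addrA subrK.
Qed.

(** The case of a vanishing inner deviation, which [integral_normal_conv] excludes; it follows from
    the translation invariance of Lebesgue measure. *)
Lemma integral_normal_translation x s h : s != 0 ->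
  measurable_fun [set: RR] h -> (forall x, 0 <= h x)%E ->
  (\int[normal_prob 0 s]_y h (x + y)%R = \int[normal_prob x s]_z h z)%E.
Proof.
move=> s0 mh h0.
have mx : measurable_fun setT (fun y : RR => x + y : RR).
  exact: measurable_funD.
have mhx : measurable_fun setT (fun y : RR => h (x + y)).
  exact: (measurableT_comp mh mx).
rewrite (integral_normal_prob _ _ mh h0).
rewrite (integral_normal_prob _ _ mhx (fun y => h0 (x + y))).
have mg : measurable_fun [set: RR] (fun z => (h z * (normal_pdf x s z)%:E)%E).
  apply: emeasurable_funM => //.
  by apply/measurable_EFinP; exact: measurable_normal_pdf.
transitivity (\int[pushforward mu (fun y : RR => (x + y)%R : RR)]_z
    (h z * (normal_pdf x s z)%:E))%E; last first.
  by apply: eq_measure_integral => A mA _; exact: lebesgue_measure_translation.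
have g0 : {in [set: RR], forall z, 0 <= h z * (normal_pdf x s z)%:E}%E.
  by move=> z _; rewrite mule_ge0// lee_fin normal_pdf_ge0.
rewrite (ge0_integral_pushforward mx mu measurableT mg g0).
rewrite preimage_setT; apply: eq_integral => y _ /=.
by rewrite !normal_pdfE// /normal_fun subr0 addrAC subrr add0r.
Qed.

Lemma iid_normal_cons s N (A : set (N.+1.-tuple RR)) : measurable A ->
  iid_normal s N.+1 A =
  (\int[normal_prob 0 s]_y iid_normal s N [set v | A (cons_pair (y, v))])%E.
Proof.
move=> mA; rewrite /= /distribution /pushforward /prod_probability.
by apply: eq_integral => y _; rewrite /= xsectionE.
Qed.

Lemma measurable_iid_normal_section s N (A : set (N.+1.-tuple RR)) :
  measurable A -> measurable_fun [set: RR]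
    (fun y => iid_normal s N [set v | A (cons_pair (y, v))]).
Proof.
move=> mA.
have mB : measurable (@cons_pair R N @^-1` A).
  by rewrite -[X in measurable X]setTI; exact: measurable_cons_pair.
have := measurable_fun_xsection (iid_normal s N) mB.
by apply: eq_measurable_fun => y _; rewrite /= xsectionE.
Qed.

(** Entries past the end of [v] read as 0. The offset [q] serves the induction of
    [iid_normal_block_sums], in which the unread part of a block precedes the others. *)
Definition block_sums (p q M N : nat) (v : N.-tuple RR) : M.-tuple RR :=
  [tuple \sum_(k < p) v`_(q + i * p + k) | i < M].
Arguments block_sums p q M {N} v.

Lemma measurable_nth_tuple N k :
  measurable_fun setT (fun v : N.-tuple RR => v`_k : RR).
Proof.
have [kN|Nk] := ltnP k N.
  rewrite (_ : (fun _ => _) = (@tnth N RR)^~ (Ordinal kN)).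
    exact: measurable_tnth.
  by apply/funext => v; rewrite (tnth_nth 0).
rewrite (_ : (fun _ => _) = cst 0); first exact: measurable_cst.
by apply/funext => v; rewrite nth_default// size_tuple.
Qed.

Lemma measurable_block_sums p q M N :
  measurable_fun setT (@block_sums p q M N : _ -> M.-tuple RR).
Proof.
apply/measurable_fun_tnthP => i.
rewrite [X in measurable_fun _ X](_ : _ =
    fun v : N.-tuple RR => \sum_(k < p) v`_(q + i * p + k)); last first.
  by apply/funext => v; rewrite /= tnth_mktuple.
by apply: measurable_sum => k; exact: measurable_nth_tuple.
Qed.

Lemma block_sums_cons p q M N y (v : N.-tuple RR) :
  block_sums p q.+1 M (cons_pair (y, v)) = block_sums p q M v.
Proof.
apply: eq_from_tnth => i; rewrite !tnth_mktuple; apply: eq_bigr => k _.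
by rewrite !addSn.
Qed.

Lemma block_sums_split p M N (v : N.-tuple RR) :
  block_sums p 0 M.+1 v =
  cons_pair (\sum_(k < p) v`_k, block_sums p p M v).
Proof.
apply: eq_from_tnth => i; rewrite tnth_mktuple.
case: (unliftP ord0 i) => [j|] ->.
  rewrite tnthS tnth_mktuple; apply: eq_bigr => k _.
  by rewrite lift0 mulSn add0n.
by apply: eq_bigr => k _; rewrite mul0n !add0n.
Qed.

(** Induction on the number of blocks: [aux] reads the first block one variable at a time, each
    adding its variance by [integral_normal_conv], and leaves the other blocks to the hypothesis. As
    a coarser dyadic level also spans a shorter interval, [N] may exceed [M * p]. *)
Lemma iid_normal_block_sums s p M N (B : set (M.-tuple RR)) :
  0 < s -> (0 < p)%N -> (M * p <= N)%N -> measurable B ->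
  iid_normal s N (block_sums p 0 M @^-1` B) =
  iid_normal (s * Num.sqrt p%:R) M B.
Proof.
move=> s0 p0; elim: M N B => [|M IH] N B.
  move=> _ mB; have [B0|nB0] := pselect (B [tuple]).
    rewrite (_ : B = setT) ?preimage_setT ?probability_setT//.
    by apply/seteqP; split => // w _; rewrite tuple0.
  rewrite (_ : B = set0) ?preimage_set0 ?measure0//.
  by apply/seteqP; split => // w; rewrite tuple0.
move=> MN mB.
pose sp := s * Num.sqrt p%:R.
(* Probability of [B] given the value [z] of the first block sum. *)
pose h (z : RR) := iid_normal sp M [set w | B (cons_pair (z, w))].
have mh : measurable_fun [set: RR] h by exact: measurable_iid_normal_section.
have h0 z : (0 <= h z)%E by [].
have s_neq0 : s != 0 by rewrite gt_eqF.
have mBs z : measurable [set w : M.-tuple RR | B (cons_pair (z, w))].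
  rewrite -[X in measurable X]setTI.
  apply: (_ : measurable_fun setT
    (fun w : M.-tuple RR => cons_pair (z, w))) => //.
  exact: (measurableT_comp (@measurable_cons_pair R M)).
have mBc q N' (g : N'.-tuple RR -> RR) : measurable_fun setT g ->
    measurable [set v : N'.-tuple RR | B (cons_pair (g v, block_sums p q M v))].
  move=> mg; rewrite -[X in measurable X]setTI.
  rewrite [X in measurable (_ `&` X)](_ : _ =
    (fun v : N'.-tuple RR => cons_pair (g v, block_sums p q M v)) @^-1` B)//.
  apply: (_ : measurable_fun setT _) => //.
  apply: (measurableT_comp (@measurable_cons_pair R M)).
  by apply/measurable_fun_pairP; split => //; exact: measurable_block_sums.
have msum x q N' : measurable_fun setT
    (fun v : N'.-tuple RR => x + \sum_(k < q) v`_k : RR).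
  apply: measurable_funD => //.
  by apply: measurable_sum => k; exact: measurable_nth_tuple.
have sq q : 0 < s * Num.sqrt q.+1%:R by rewrite mulr_gt0// sqrtr_gt0 ltr0n.
(* [x] is the part of the current block that has already been read *)
have aux q : forall x N' s', s' = s * Num.sqrt q.+1%:R ->
    (q.+1 + M * p <= N')%N ->
    iid_normal s N' [set v : N'.-tuple RR |
      B (cons_pair (x + \sum_(k < q.+1) v`_k, block_sums p q.+1 M v))] =
    (\int[normal_prob x s']_z h z)%E.
  elim: q => [|q IHq] x [//|N'] s' s'E qN.
    (* At the last variable of the block, the induction hypothesis on [M] supplies the law of the
       following blocks. *)
    have {s'E} -> : s' = s by rewrite s'E sqrtr1 mulr1.
    rewrite iid_normal_cons; last exact: (mBc _ _ _ (msum x 1%N _)).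
    rewrite -(integral_normal_translation x s_neq0 mh h0).
    apply: eq_integral => y _; rewrite /h -(IH N' _ qN (mBs (x + y))).
    congr (iid_normal _ _ _); apply/funext => v /=.
    by rewrite big_ord1 /= block_sums_cons.
  rewrite iid_normal_cons; last exact: (mBc _ _ _ (msum x q.+2 _)).
  have {s'E} -> : s' = Num.sqrt ((s * Num.sqrt q.+1%:R) ^+ 2 + s ^+ 2).
    rewrite s'E exprMn sqr_sqrtr// -[X in _ + X]mulr1 -mulrDr natr1.
    by rewrite sqrtrM ?sqr_ge0// sqrtr_sqr gtr0_norm.
  rewrite -(integral_normal_conv x (sq q) s0 mh h0).
  apply: eq_integral => y _; rewrite -(IHq _ N' _ erefl qN).
  congr (iid_normal _ _ _); apply/funext => v /=.
  by rewrite block_sums_cons big_ord_recl /= addrA.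
rewrite (iid_normal_cons _ mB).
rewrite -(aux p.-1 0 N) ?prednK//.
congr (iid_normal _ _ _); apply/funext => v /=.
by rewrite add0r block_sums_split.
Qed.

End iid_normal_blocks.

Arguments block_sums {R} p q M {N} v.

(** * Dyadic increments *)

Section dyadic_increments.
Context {R : realType}.
Local Notation RR := (measurableTypeR R).
Implicit Types (x : Cinfty R) (n m k i : nat).

Definition dyadic_increments n x : (4 ^ n).-tuple RR :=
  [tuple x (i.+1%:R / 2 ^+ n) - x (i%:R / 2 ^+ n) | i < 4 ^ n].

Definition dyadic_law n : probability ((4 ^ n).-tuple RR) R :=
  iid_normal (Num.sqrt (2 ^+ n)^-1) (4 ^ n).

Lemma nth_dyadic_increments n x k : (k < 4 ^ n)%N ->
  (dyadic_increments n x)`_k = x (k.+1%:R / 2 ^+ n) - x (k%:R / 2 ^+ n).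
Proof.
by move=> kn; rewrite -[k]/(val (Ordinal kn)) -tnth_nth tnth_mktuple.
Qed.

Lemma sum_dyadic_increments n x p i : (i.+1 * p <= 4 ^ n)%N ->
  \sum_(k < p) (dyadic_increments n x)`_(i * p + k) =
  x ((i.+1 * p)%:R / 2 ^+ n) - x ((i * p)%:R / 2 ^+ n).
Proof.
move=> ipn.
rewrite -(big_mkord xpredT (fun k => (dyadic_increments n x)`_(i * p + k))).
rewrite (eq_big_nat _ _ (F2 := fun k => x ((i * p + k).+1%:R / 2 ^+ n) -
    x ((i * p + k)%:R / 2 ^+ n))); last first.
  move=> k /= kp; rewrite nth_dyadic_increments//.
  by rewrite (leq_trans _ ipn)// mulSn addnC ltn_add2r.
pose g k := x ((i * p + k)%:R / 2 ^+ n).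
rewrite (eq_bigr (fun k => g k.+1 - g k)); last by move=> k _; rewrite /g addnS.
by rewrite telescope_sumr// /g addn0 mulSn addnC.
Qed.

(** Level [n] reaches up to time [2 ^ n], so only its first [2 ^ (n + m)] increments are summed. *)
Lemma dyadic_increments_coarsen m n x : (m <= n)%N ->
  dyadic_increments m x =
  block_sums (2 ^ (n - m)) 0 (4 ^ m) (dyadic_increments n x).
Proof.
move=> mn; apply: eq_from_tnth => i; rewrite !tnth_mktuple.
have e2 : (2 ^ n = 2 ^ m * 2 ^ (n - m))%N by rewrite -expnD subnKC.
rewrite (eq_bigr (fun k : 'I__ =>
  (dyadic_increments n x)`_(i * 2 ^ (n - m) + k)))//.
rewrite sum_dyadic_increments; last first.
  have -> : (4 ^ n = 4 ^ m * (2 ^ (n - m) * 2 ^ (n - m)))%N.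
    by rewrite -expnMn -expnD subnKC.
  apply: leq_mul; first exact: ltn_ord.
  by rewrite leq_pmull// expn_gt0.
have -> : 2 ^+ n = 2 ^+ m * (2 ^ (n - m))%:R :> R.
  by rewrite -natrX e2 natrM natrX.
have p0 : (2 ^ (n - m))%:R != 0 :> R by rewrite pnatr_eq0 -lt0n expn_gt0.
by rewrite !natrM -!mulf_div divff// !mulr1.
Qed.

(** Consecutive nodes [r * k / 2 ^ n] are [r * 2 ^ (m - n)] steps of level [m] apart, and
    [r <= 2 ^ m] keeps them within the range of that level. *)
Lemma increments_coarsen (r n m : nat) x : (n <= m)%N -> (r <= 2 ^ m)%N ->
  increments n (Qrestr r x) =
  block_sums (r * 2 ^ (m - n)) 0 (2 ^ n) (dyadic_increments m x).
Proof.
move=> nm rm; apply: eq_from_tnth => i; rewrite !tnth_mktuple.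
have e2 : (2 ^ m = 2 ^ n * 2 ^ (m - n))%N by rewrite -expnD subnKC.
rewrite (eq_bigr (fun k : 'I__ =>
  (dyadic_increments m x)`_(i * (r * 2 ^ (m - n)) + k)))//.
rewrite sum_dyadic_increments; last first.
  have -> : (4 ^ m = 2 ^ n * (2 ^ m * 2 ^ (m - n)))%N.
    by rewrite mulnCA -e2 -expnMn.
  by apply: leq_mul; [exact: ltn_ord|rewrite leq_mul2r rm orbT].
have p0 : (2 ^ (m - n))%:R != 0 :> R by rewrite pnatr_eq0 -lt0n expn_gt0.
have node k : (k <= 2 ^ n)%N -> Qrestr r x (r%:R * k%:R / 2 ^+ n) =
    x ((k * (r * 2 ^ (m - n)))%:R / 2 ^+ m).
  move=> kn; rewrite /= /patch mem_set/=; last first.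
    rewrite in_itv/= divr_ge0 ?mulr_ge0//=.
    by rewrite ler_pdivrMr ?exprn_gt0// ler_wpM2l// -natrX ler_nat.
  congr (path_fun x _).
  have -> : 2 ^+ m = 2 ^+ n * (2 ^ (m - n))%:R :> R.
    by rewrite -natrX e2 natrM natrX.
  by rewrite !natrM mulrA -mulf_div divff// mulr1 (mulrC r%:R).
by rewrite !node//; exact: ltnW.
Qed.

Lemma dyadic_law_block_sums p M n (B : set (M.-tuple RR)) :
  (0 < p)%N -> (M * p <= 4 ^ n)%N -> measurable B ->
  dyadic_law n (block_sums p 0 M @^-1` B) =
  iid_normal (Num.sqrt (p%:R / 2 ^+ n)) M B.
Proof.
move=> p0 Mp mB; rewrite /dyadic_law iid_normal_block_sums//.
by rewrite -sqrtrM ?invr_ge0 ?exprn_ge0// mulrC.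
Qed.

(** Consistency of the finite-dimensional laws: [2 ^ (n - m)] variances [2 ^- n] add up to
    [2 ^- m]. *)
Lemma dyadic_law_coarsen m n (B : set ((4 ^ m).-tuple RR)) :
  (m <= n)%N -> measurable B ->
  dyadic_law n (block_sums (2 ^ (n - m)) 0 (4 ^ m) @^-1` B) = dyadic_law m B.
Proof.
move=> mn mB; rewrite dyadic_law_block_sums ?expn_gt0//; last first.
  have -> : (4 ^ n = 4 ^ m * (2 ^ (n - m) * 2 ^ (n - m)))%N.
    by rewrite -expnMn -expnD subnKC.
  by apply: leq_mul => //; rewrite leq_pmull// expn_gt0.
congr (iid_normal (Num.sqrt _) _ _).
have -> : 2 ^+ n = 2 ^+ m * 2 ^+ (n - m) :> R by rewrite -exprD subnKC.
by rewrite natrX invfM mulrCA divff ?mulr1// expf_neq0.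
Qed.

(** Here [r * 2 ^ (m - n)] variances [2 ^- m] add up to [r / 2 ^ n], the variance in [nu]. *)
Lemma nu_coarsen (r n m : nat) (B : set ((2 ^ n).-tuple RR)) :
  (0 < r)%N -> (n <= m)%N -> (r <= 2 ^ m)%N -> measurable B ->
  dyadic_law m (block_sums (r * 2 ^ (m - n)) 0 (2 ^ n) @^-1` B) =
  nu r%:R n B.
Proof.
move=> r0 nm rm mB; rewrite dyadic_law_block_sums ?muln_gt0 ?r0 ?expn_gt0//.
  congr (iid_normal (Num.sqrt _) _ _).
  have -> : 2 ^+ m = 2 ^+ n * 2 ^+ (m - n) :> R by rewrite -exprD subnKC.
  by rewrite natrM natrX -mulf_div divff ?mulr1// expf_neq0.
have e2 : (2 ^ m = 2 ^ n * 2 ^ (m - n))%N by rewrite -expnD subnKC.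
have -> : (4 ^ m = 2 ^ n * (2 ^ m * 2 ^ (m - n)))%N.
  by rewrite mulnCA -e2 -expnMn.
by rewrite leq_pmul2l ?expn_gt0// leq_mul2r rm orbT.
Qed.

End dyadic_increments.

(** * Piecewise linear paths with prescribed increments *)

Section interpolation.
Context {R : realType}.
Local Notation RR := (measurableTypeR R).
Variables (n : nat) (v : (4 ^ n).-tuple RR).
Implicit Types (m k i : nat).

Definition ramp (u : R) : R := Num.max 0 (Num.min 1 u).

Lemma ramp_ge1 u : 1 <= u -> ramp u = 1.
Proof. by move=> u1; rewrite /ramp min_l ?max_r. Qed.

Lemma ramp_le0 u : u <= 0 -> ramp u = 0.
Proof. by move=> u0; rewrite /ramp max_l// ge_min u0 orbT. Qed.

Lemma ramp_id u : 0 <= u <= 1 -> ramp u = u.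
Proof. by case/andP=> u0 u1; rewrite /ramp min_r// max_r. Qed.

Lemma continuous_ramp : continuous ramp.
Proof.
move=> u; apply: (@continuous_max R R (fun=> 0)); first exact: cvg_cst.
by apply: (@continuous_min R R (fun=> 1)); [exact: cvg_cst|exact: cvg_id].
Qed.

(** The broken line with increments [v]: the ramp of index [i] rises from 0 to 1 between the nodes
    [i] and [i + 1] of level [n], so the path is constant from time [2 ^ n] on. *)
Definition interp (t : R) : R :=
  \sum_(i < 4 ^ n) tnth v i * ramp (t * 2 ^+ n - i%:R).

Lemma continuous_interp : continuous interp.
Proof.
apply: continuous_big => [|i _ t]; first exact: add_continuous.
apply: cvgM; first exact: cvg_cst.
apply: (@continuous_comp R R R (fun t => t * 2 ^+ n - i%:R) ramp t).
  apply: cvgB; last exact: cvg_cst.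
  by apply: cvgM; [exact: cvg_id|exact: cvg_cst].
exact: continuous_ramp.
Qed.

Lemma interp0 : interp 0 = 0.
Proof.
by rewrite /interp big1// => i _; rewrite mul0r ramp_le0 ?mulr0// sub0r oppr_le0.
Qed.

Definition interp_path : Cinfty R :=
  restr_path (@subsetT _ `[0, +oo[) (PathOn (I := setT)
    (continuous_subspaceT continuous_interp) interp0
    (fun t (nt : ~ setT t) => False_ind _ (nt I))).

Lemma interp_pathE t : 0 <= t -> interp_path t = interp t.
Proof. by move=> t0; rewrite /= /patch mem_set//= in_itv/= t0. Qed.

(** Between the nodes [q] and [q + 1] only the ramp of index [q] moves; past the last node the
    default entry 0 matches the constant path. *)
Lemma interp_affine q (u e : R) : q%:R <= u -> 0 <= e -> u + e <= q.+1%:R ->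
  interp ((u + e) / 2 ^+ n) - interp (u / 2 ^+ n) = v`_q * e.
Proof.
move=> qu e0 ue.
rewrite /interp -sumrB; under eq_bigr do
  rewrite -mulrBr !divfK ?expf_neq0//.
have ramp_other i : i != q -> ramp (u + e - i%:R) - ramp (u - i%:R) = 0.
  rewrite neq_ltn => /orP[iq|qi].
    have iq' : i.+1%:R <= q%:R :> R by rewrite ler_nat.
    rewrite -natr1 in iq'.
    by rewrite !ramp_ge1 ?subrr//; lra.
  have qi' : q.+1%:R <= i%:R :> R by rewrite ler_nat.
  by rewrite !ramp_le0 ?subrr//; lra.
have [qn|nq] := ltnP q (4 ^ n); last first.
  rewrite nth_default ?size_tuple// mul0r big1// => i _.
  by rewrite ramp_other ?mulr0// neq_ltn (leq_trans (ltn_ord i)).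
rewrite (bigD1 (Ordinal qn))//= big1 ?addr0; last first.
  by move=> i iq; rewrite ramp_other ?mulr0.
rewrite -natr1 in ue.
by rewrite (tnth_nth 0) /= !ramp_id; [congr (_ * _)| |]; lra.
Qed.

Lemma interp_node k : (k <= 4 ^ n)%N ->
  interp (k%:R / 2 ^+ n) = \sum_(i < k) v`_i.
Proof.
elim: k => [|k IH] kn; first by rewrite mul0r interp0 big_ord0.
have := @interp_affine k k%:R 1 (lexx _) ler01; rewrite natr1 lexx => /(_ isT).
rewrite mulr1 => /eqP; rewrite subr_eq => /eqP ->.
by rewrite big_ord_recr/= addrC IH// ltnW.
Qed.

Lemma dyadic_increments_interp : dyadic_increments n interp_path = v.
Proof.
apply: eq_from_tnth => i; rewrite tnth_mktuple.
rewrite !interp_pathE ?divr_ge0 ?exprn_ge0//.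
rewrite !interp_node ?(ltnW (ltn_ord _))// big_ord_recr/= addrAC subrr add0r.
by rewrite -tnth_nth.
Qed.

End interpolation.

(** * Probability of a dyadic modulus *)

Section concentration.
Context {R : realType}.
Local Notation RR := (measurableTypeR R).
Implicit Types (x : Cinfty R) (C : R) (n m k i : nat).

(* Any ratio [q < 1] with [4 < (2 * q ^+ 2) ^+ 4] would do: the exceptional
   probabilities of all the dyadic levels are then summable, see
   [level_bound]. *)
Definition dyadic_bounded C (f : R -> R) := forall m k, (k < 4 ^ m)%N ->
  `|f (k.+1%:R / 2 ^+ m) - f (k%:R / 2 ^+ m)| <= C * (9 / 10) ^+ m.

Definition dyadic_modulus_le C : set (Cinfty R) := [set x | dyadic_bounded C x].

Lemma iid_normal_marginal (s : R) N (i : 'I_N) (A : set RR) : measurable A ->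
  iid_normal s N [set v | A (tnth v i)] = normal_prob 0 s A.
Proof.
move=> mA; pose B (j : 'I_N) : set RR := if j == i then A else setT.
have mB j : measurable (B j) by rewrite /B; case: ifP.
rewrite (_ : [set v | _] = [set v | forall j, B j (tnth v j)]); last first.
  apply/seteqP; split => v /= => [Av j|/(_ i)]; last by rewrite /B eqxx.
  by rewrite /B; case: ifP => // /eqP ->.
rewrite iid_normal_box// (bigD1 i)//= big1 ?mule1 => [|j ji].
  by rewrite /B eqxx.
by rewrite /B (negbTE ji) (@probability_setT _ _ _ (normal_prob 0 s)).
Qed.

Lemma measurable_coord_gt N k (d : R) :
  measurable [set w : N.-tuple RR | d < `|w`_k|].
Proof.
rewrite -[X in measurable X]setTI.
exact: (@measurable_nth_tuple R N k measurableT _ (measurable_norm_gt d)).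
Qed.

Lemma dyadic_law_coord_gt C m k : 0 < C -> (k < 4 ^ m)%N ->
  (dyadic_law m [set w | (C * (9 / 10) ^+ m < `|w`_k|)%R] <=
   (48 * (4 / (2 ^+ m * (C * (9 / 10) ^+ m) ^+ 2)) ^+ 4 : R)%:E)%E.
Proof.
move=> C0 km.
have d0 : 0 < C * (9 / 10) ^+ m by rewrite mulr_gt0// exprn_gt0// divr_gt0.
have s0 : 0 < Num.sqrt (2 ^+ m)^-1 :> R by rewrite sqrtr_gt0 invr_gt0 exprn_gt0.
rewrite [X in dyadic_law m X](_ : _ = [set w |
    [set y : RR | C * (9 / 10) ^+ m < `|y|] (tnth w (Ordinal km))]); last first.
  by apply/funext => w /=; rewrite (tnth_nth 0).
rewrite /dyadic_law iid_normal_marginal; last exact: measurable_norm_gt.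
(* The exponent is [3.+1], and 48 is twice the factorial of 4. In [level_bound] this fourth power
   outweighs the number [4 ^ m] of increments of level [m]. *)
apply: le_trans (normal_prob_tail 3 s0 d0) _.
rewrite sqr_sqrtr ?invr_ge0 ?exprn_ge0// lee_fin.
set d := C * _ in d0 *.
have -> : 4 * (2 ^+ m)^-1 / d ^+ 2 = 4 / (2 ^+ m * d ^+ 2).
  by rewrite [in RHS]invfM mulrA.
rewrite ler_wpM2r//; last by rewrite -natrM ler_nat.
by rewrite exprn_ge0// divr_ge0// mulr_ge0// exprn_ge0// ltW.
Qed.

(** The left side is [48 * 4 ^+ 4 / C ^+ 8] times the [m]-th power of
    [4 / (2 * (9 / 10) ^+ 2) ^+ 4], which is about 0.581 and so below 3/5; [1 <= C] weakens [C ^+ 8]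
    to [C]. *)
Lemma level_bound C m : 1 <= C ->
  4 ^+ m * (48 * (4 / (2 ^+ m * (C * (9 / 10) ^+ m) ^+ 2)) ^+ 4) <=
  48 * 4 ^+ 4 / C * (3 / 5) ^+ m :> R.
Proof.
move=> C1; have C0 : 0 < C by rewrite (lt_le_trans _ C1).
have q0 : 0 < (9 / 10 : R) ^+ m by rewrite exprn_gt0.
have p0 : 0 < (2 : R) ^+ m by rewrite exprn_gt0.
rewrite [leLHS](_ : _ = 48 * 4 ^+ 4 / C ^+ 8 *
    (4 * (2 * (9 / 10) ^+ 2)^-1 ^+ 4) ^+ m); last first.
  set q : R := 9 / 10.
  have -> : (4 * (2 * q ^+ 2)^-1 ^+ 4) ^+ m =
      4 ^+ m * ((2 ^+ m * (q ^+ m) ^+ 2)^-1) ^+ 4.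
    have e : (2 * q ^+ 2)^-1 ^+ m = (2 ^+ m * (q ^+ m) ^+ 2)^-1.
      by rewrite exprVn exprMn (exprAC q).
    by rewrite exprMn -e -!(exprM (_^-1)) mulnC.
  have q1 : 0 < q by rewrite divr_gt0.
  have : 2 ^+ m * (q ^+ m) ^+ 2 != 0.
    by rewrite gt_eqF// mulr_gt0// ?exprn_gt0// exprn_gt0.
  have -> : 2 ^+ m * (C * q ^+ m) ^+ 2 = C ^+ 2 * (2 ^+ m * (q ^+ m) ^+ 2).
    by rewrite exprMn mulrCA.
  set a := 2 ^+ m * _; move: a (4 ^+ m : R) => a b a0.
  by field; rewrite a0 gt_eqF.
apply: ler_pM.
- by rewrite divr_ge0 ?exprn_ge0// ltW.
- by rewrite exprn_ge0// mulr_ge0// exprn_ge0// invr_ge0 mulr_ge0.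
- rewrite ler_pM2l// lef_pV2 ?posrE ?exprn_gt0//.
  by rewrite -[leLHS]expr1 ler_weXn2l.
- apply: lerXn2r; rewrite ?nnegrE.
  + by rewrite mulr_ge0// exprn_ge0// invr_ge0 mulr_ge0.
  + by rewrite divr_ge0.
  + lra.
Qed.

(** Only the levels up to [n] have to be checked: beyond them the path is affine between nodes, so
    the increments are halved at each level, and [1 / 2 <= 9 / 10]. *)
Lemma dyadic_modulus_interp C n (v : (4 ^ n).-tuple RR) : 0 <= C ->
  (forall m k, (m <= n)%N -> (k < 4 ^ m)%N ->
    `|(block_sums (2 ^ (n - m)) 0 (4 ^ m) v)`_k| <= C * (9 / 10) ^+ m) ->
  dyadic_modulus_le C (interp_path v).
Proof.
move=> C0 vC m k km.
have [mn|nm] := leqP m n.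
  rewrite -nth_dyadic_increments// (dyadic_increments_coarsen _ mn).
  by rewrite dyadic_increments_interp; exact: vC.
pose p := (2 ^ (m - n))%N; pose q := (k %/ p)%N.
have p0 : (0 < p)%N by rewrite expn_gt0.
have pR : (p%:R : R) = 2 ^+ (m - n) by rewrite natrX.
have e2 : 2 ^+ m = 2 ^+ n * p%:R :> R by rewrite pR -exprD subnKC// ltnW.
have pn0 : p%:R != 0 :> R by rewrite pnatr_eq0 -lt0n.
rewrite !interp_pathE ?divr_ge0 ?exprn_ge0// e2.
have -> : k.+1%:R / (2 ^+ n * p%:R) = (k%:R / p%:R + p%:R^-1) / 2 ^+ n :> R.
  by rewrite -natr1 invfM mulrA mulrAC mulrDl mul1r.
have -> : k%:R / (2 ^+ n * p%:R) = (k%:R / p%:R) / 2 ^+ n :> R.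
  by rewrite invfM mulrA mulrAC.
rewrite (@interp_affine _ _ _ q); first last.
- rewrite -[X in _ + X]mul1r -mulrDl natr1 ler_pdivrMr ?ltr0n// -natrM ler_nat.
  exact: ltn_ceil.
- by rewrite invr_ge0.
- by rewrite ler_pdivlMr ?ltr0n// -natrM ler_nat leq_trunc_div.
rewrite normrM [X in _ * X]ger0_norm ?invr_ge0//.
have vq : `|v`_q| <= C * (9 / 10) ^+ n.
  have [qn|nq] := ltnP q (4 ^ n); last first.
    by rewrite nth_default ?size_tuple// normr0 mulr_ge0// exprn_ge0// divr_ge0.
  have := vC n q (leqnn _) qn.
  rewrite subnn expn0 -[X in _`_X]/(val (Ordinal qn)) -tnth_nth tnth_mktuple.
  by rewrite big_ord1 add0n muln1 addn0.
apply: le_trans (ler_wpM2r _ vq) _; first by rewrite invr_ge0.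
rewrite -mulrA ler_wpM2l// -[X in _ <= _ ^+ X](subnKC (ltnW nm)) exprD.
rewrite ler_wpM2l ?exprn_ge0// pR -exprVn lerXn2r ?nnegrE//; lra.
Qed.

(** Outside [bad], the union of the exceptional events of the levels up to [n], the broken line
    through [v] has the modulus, so its increments [v] lie in [B]. *)
Lemma dyadic_law_concentrated C n (B : set ((4 ^ n).-tuple RR)) : 1 <= C ->
  measurable B ->
  (forall x, dyadic_modulus_le C x -> B (dyadic_increments n x)) ->
  (1 - (120 * 4 ^+ 4 / C)%:E <= dyadic_law n B)%E.
Proof.
move=> C1 mB KB; have C0 : 0 < C by rewrite (lt_le_trans _ C1).
pose E m k : set ((4 ^ n).-tuple RR) := if (m <= n)%N && (k < 4 ^ m)%N then
  block_sums (2 ^ (n - m)) 0 (4 ^ m) @^-1`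
    [set w | C * (9 / 10) ^+ m < `|w`_k|] else set0.
pose bad := \big[setU/set0]_(m < n.+1) \big[setU/set0]_(k < 4 ^ m) E m k.
have mE m k : measurable (E m k).
  rewrite /E; case: ifP => // _; rewrite -[X in measurable X]setTI.
  apply: (@measurable_block_sums R _ _ _ _ measurableT).
  exact: measurable_coord_gt.
have mbad : measurable bad.
  by apply: bigsetU_measurable => m _; exact: bigsetU_measurable.
have badB : ~` bad `<=` B.
  move=> v nbad; rewrite -(dyadic_increments_interp v); apply: KB.
  apply: dyadic_modulus_interp; first exact: ltW.
  move=> m k mn km; rewrite leNgt; apply/negP => vk; apply: nbad.
  have Ev : E m k v by rewrite /E mn km.
  have := @bigcup_mkord _ n.+1 (fun m => \big[setU/set0]_(k < 4 ^ m) E m k).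
  rewrite -/bad => <-; exists m => //.
  by rewrite -(bigcup_mkord (4 ^ m) (E m)); exists k.
have le_bad : (dyadic_law n bad <= (120 * 4 ^+ 4 / C)%:E)%E.
  have mEm m : measurable (\big[setU/set0]_(k < 4 ^ m) E m k).
    exact: bigsetU_measurable.
  have := @Boole_inequality _ _ _ (dyadic_law n) _ n.+1 (fun m _ => mEm m).
  move=> /le_trans; apply.
  apply: (@le_trans _ _ (\sum_(m < n.+1) (48 * 4 ^+ 4 / C * (3 / 5) ^+ m)%:E)%E).
    apply: lee_sum => m _.
    have := @Boole_inequality _ _ _ (dyadic_law n) _ (4 ^ m) (fun k _ => mE m k).
    move=> /le_trans; apply.
    apply: (@le_trans _ _ (\sum_(k < 4 ^ m)
      (48 * (4 / (2 ^+ m * (C * (9 / 10) ^+ m) ^+ 2)) ^+ 4)%:E)%E).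
      apply: lee_sum => k _; have mn : (m <= n)%N by rewrite -ltnS.
      rewrite /E mn ltn_ord/= dyadic_law_coarsen//; last first.
        exact: measurable_coord_gt.
      exact: dyadic_law_coord_gt.
    rewrite sumEFin lee_fin sumr_const card_ord -[leLHS]mulr_natl natrX.
    exact: level_bound.
  rewrite sumEFin lee_fin.
  have q35 : `|3 / 5 : R| < 1 by rewrite ger0_norm ?divr_ge0//; lra.
  have c0 : 0 <= 48 * 4 ^+ 4 / C by rewrite divr_ge0// ltW.
  have q0 : 0 < 3 / 5 :> R by rewrite divr_gt0.
  (* The geometric series of ratio 3/5 has sum 5/2, and [48 * 5 / 2 = 120]. *)
  have := geometric_le_lim n.+1 c0 q0 q35.
  rewrite /series/= big_mkord => /le_trans; apply.
  rewrite (_ : 48 * 4 ^+ 4 / C / _ = 120 * 4 ^+ 4 / C)//.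
  by field; rewrite gt_eqF.
apply: (@le_trans _ _ (dyadic_law n (~` bad))).
  by rewrite probability_setC// leeB.
by apply: le_measure => //; rewrite inE//; exact: measurableC.
Qed.

End concentration.

(** * Topology of path spaces *)

Section path_topology.
Context {R : realType}.
Implicit Types (I : set R) (f : R -> R) (t s e a : R).

Lemma within_continuousP I f : {within I, continuous f} <->
  forall t e, I t -> 0 < e ->
    exists2 d, 0 < d & forall s, I s -> `|t - s| < d -> `|f t - f s| < e.
Proof.
split=> [/subspace_continuousP fc t e It e0|fc].
  have /cvgrPdist_lt/(_ _ e0) := fc t It.
  rewrite near_withinE => /nbhs_ballP[d /= d0 dP].
  by exists d => // s Is sd; exact: dP.
apply/subspace_continuousP => t It; apply/cvgrPdist_lt => e e0.
have [d d0 dP] := fc t e It e0.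
rewrite near_withinE; apply/nbhs_ballP; exists d => //= s sd Is.
exact: dP.
Qed.

Lemma exp_small (q e : R) : 0 <= q < 1 -> 0 < e -> exists m, q ^+ m < e.
Proof.
move=> /andP[q0 q1] e0.
have /cvg_expr/cvgrPdist_lt/(_ _ e0) : `|q| < 1 by rewrite ger0_norm.
case=> m _ /(_ m (leqnn m)) /=; rewrite sub0r normrN ger0_norm ?exprn_ge0//.
by exists m.
Qed.

Lemma sup_dist_mono a b f g : a <= b ->
  {within `[0, b], continuous f} -> {within `[0, b], continuous g} ->
  sup_dist a f g <= sup_dist b f g.
Proof.
move=> ab cf cg; apply: sup_dist_le; first exact: sup_dist_ge0.
move=> t /andP[t0 ta]; apply: sup_dist_ub => //.
by rewrite t0 (le_trans ta).
Qed.

Section Cinfty_dist.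
Implicit Types x y : Cinfty R.

Let term x y (n : nat) : R :=
  2^-1 ^+ n * (sup_dist n%:R x y / (1 + sup_dist n%:R x y)).
Let psum x y n : R := \sum_(1 <= k < n) term x y k.

Let half_ge0 n : (0 : R) <= 2^-1 ^+ n.
Proof. by rewrite exprn_ge0// invr_ge0. Qed.

Let term_ge0 x y n : 0 <= term x y n.
Proof.
by rewrite mulr_ge0// divr_ge0 ?sup_dist_ge0// addr_ge0// sup_dist_ge0.
Qed.

Let psum_nd x y : nondecreasing_seq (psum x y).
Proof.
apply/nondecreasing_seqP => -[|n]; first by rewrite /psum !big_geq.
by rewrite {2}/psum big_nat_recr//= lerDl.
Qed.

(** The terms of index [k] at most [N] are bounded by [2 ^- k * e], as the sup distance grows with
    the interval, and the later ones by [2 ^- k]. *)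
Let psum_le x y N e n : sup_dist N%:R x y <= e ->
  psum x y n <= e + 2^-1 ^+ N.
Proof.
move=> xye; have s0 k := sup_dist_ge0 k%:R x y.
have e0 : 0 <= e by apply: le_trans xye.
have s1 k : 0 < 1 + sup_dist k%:R x y by rewrite ltr_pwDl.
have h1 k : 2^-1 ^+ k <= 1 :> R.
  by rewrite exprn_ile1 ?invr_ge0// invf_le1// ler1n.
(* Closed forms of the sums of these bounds, on both sides of [N]. *)
suff main k : psum x y k.+1 <= if (k <= N)%N then e * (1 - 2^-1 ^+ k)
    else e * (1 - 2^-1 ^+ N) + (2^-1 ^+ N - 2^-1 ^+ k).
  case: n => [|n]; first by rewrite /psum big_geq// addr_ge0.
  apply: le_trans (main n) _; case: ifP => _.
    by rewrite mulrBr mulr1 lerD// (le_trans _ (half_ge0 _))// oppr_le0 mulr_ge0.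
  have := mulr_ge0 e0 (half_ge0 N); have := half_ge0 n.
  by rewrite mulrBr mulr1; lra.
elim: k => [|k ih]; first by rewrite /psum big_geq// expr0 subrr mulr0.
rewrite /psum big_nat_recr//= -/(psum x y k.+1).
have [kN|Nk] := ltnP k N.
  rewrite (ltnW kN) in ih.
  have : term x y k.+1 <= 2^-1 ^+ k.+1 * e.
    rewrite ler_wpM2l// ler_pdivrMr//.
    apply: (@le_trans _ _ e); last by rewrite ler_peMr// lerDl.
    apply: le_trans xye; apply: sup_dist_mono; try exact: Cinfty_continuous.
    by rewrite ler_nat.
  move=> /(lerD ih)/le_trans; apply; rewrite le_eqVlt; apply/orP; left; apply/eqP.
  by rewrite exprS; field.
have : term x y k.+1 <= 2^-1 ^+ k.+1.
  by rewrite ler_piMr// ler_pdivrMr// mul1r lerDr.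
move=> /(lerD ih)/le_trans; apply.
case: ifP => kN; last by rewrite exprS; lra.
have -> : N = k by apply/eqP; rewrite eqn_leq Nk.
by rewrite exprS; lra.
Qed.

Let psum_cvg x y : cvgn (psum x y).
Proof.
apply: nondecreasing_is_cvgn; first exact: psum_nd.
by exists (sup_dist 0%:R x y + 2^-1 ^+ 0) => _ [n _ <-]; exact: psum_le.
Qed.

Lemma Cinfty_dist_le x y N e : sup_dist N%:R x y <= e ->
  Cinfty_dist x y <= e + 2^-1 ^+ N.
Proof.
move=> xye; apply: limr_le; first exact: psum_cvg.
by apply: nearW => n; exact: psum_le.
Qed.

(** The term of index [n.+1] is below the distance, and [u / (1 + u)] increases with [u]. Together
    with [Cinfty_dist_le], this makes convergence in the metric locally uniform convergence. *)
Lemma Cinfty_dist_sup n e : 0 < e -> exists2 d, 0 < d &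
  forall x y, Cinfty_dist x y < d -> sup_dist n.+1%:R x y < e.
Proof.
move=> e0; have e1 : 0 < 1 + e by rewrite addr_gt0.
have h0 : 0 < 2^-1 ^+ n.+1 :> R by rewrite exprn_gt0// invr_gt0.
exists (2^-1 ^+ n.+1 * (e / (1 + e))) => [|x y].
  by rewrite mulr_gt0// divr_gt0.
have : term x y n.+1 <= Cinfty_dist x y.
  apply: (@le_trans _ _ (psum x y n.+2)).
    by rewrite /psum big_nat_recr//= lerDr sumr_ge0.
  by apply: nondecreasing_cvgn_le; [exact: psum_nd|exact: psum_cvg].
move=> /le_lt_trans /[apply]; rewrite ltr_pM2l//.
have s0 := sup_dist_ge0 n.+1%:R x y.
have s1 : 0 < 1 + sup_dist n.+1%:R x y by rewrite ltr_pwDl.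
by rewrite ltr_pdivrMr// mulrAC ltr_pdivlMr//; lra.
Qed.

Lemma ball_Cinfty x e : ball x e = [set y | Cinfty_dist x y < e].
Proof. by []. Qed.

Lemma continuous_Cinfty_eval t : continuous (fun x : Cinfty R => x t).
Proof.
have [t0|t0] := ltP t 0.
  rewrite (_ : (fun _ => _) = cst 0); first exact: cst_continuous.
  apply/funext => x; apply: path_out => /=.
  by rewrite in_itv/= andbT leNgt t0.
move=> x; apply/(cvgrPdist_lt (FF := nbhs_filter x)) => e e0.
have [d d0 dP] := Cinfty_dist_sup (Num.truncn t) e0.
apply/nbhs_ballP; exists d => //= y; rewrite ball_Cinfty/= => /dP.
apply: le_lt_trans; apply: sup_dist_ub; try exact: Cinfty_continuous.
by rewrite t0 ltW// truncnS_gt.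
Qed.

Lemma continuous_Cpath_eval a t : continuous (fun x : Cpath a => x t).
Proof.
move=> x; apply/(cvgrPdist_lt (FF := nbhs_filter x)) => e e0.
apply/nbhs_ballP; exists e => //= y.
rewrite [ball x e](_ : _ = [set y : Cpath a | sup_dist a x y < e])//=.
apply: le_lt_trans; have [ta|nta] := boolP (0 <= t <= a).
  by apply: sup_dist_ub => //; exact: path_continuous.
rewrite !path_out/= ?in_itv/= ?subrr ?normr0 ?sup_dist_ge0//; exact/negP.
Qed.

Lemma continuous_Qrestr r : continuous (@Qrestr R r).
Proof.
move=> x; apply/(cvg_ballP (FF := nbhs_filter x)) => e e0.
have e20 : 0 < e / 2 by rewrite divr_gt0.
have [d d0 dP] := Cinfty_dist_sup r e20.
apply/nbhs_ballP; exists d => //= y; rewrite ball_Cinfty/= => /dP xy.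
rewrite [ball _ e](_ : _ = [set z : Cpath r%:R |
  sup_dist r%:R (Qrestr r x) z < e])//=.
apply: (@le_lt_trans _ _ (e / 2)); last by rewrite ltr_pdivrMr// ltr_pMr// ltr1n.
apply: sup_dist_le => [|t tr]; first exact: ltW.
rewrite /= /patch !mem_set/= ?in_itv//= ltW// (le_lt_trans _ xy)//.
apply: sup_dist_ub; try exact: Cinfty_continuous.
by case/andP: tr => -> /le_trans -> //; rewrite ler_nat.
Qed.

End Cinfty_dist.
End path_topology.

(** * Chaining over dyadic levels *)

Section dyadic_chaining.
Context {R : realType}.
Implicit Types (f : R -> R) (C t s : R) (m k i : nat).
Local Notation rho := (9 / 10 : R).

Let rho_ge0 m : 0 <= rho ^+ m. Proof. by rewrite exprn_ge0// divr_ge0. Qed.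

Let rho_le1 m : rho ^+ m <= 1.
Proof. by rewrite exprn_ile1 ?divr_ge0//; lra. Qed.

Lemma exists_level (T A e : R) : 0 <= A -> 0 < e ->
  exists m, T < 2 ^+ m /\ A * rho ^+ m < e.
Proof.
move=> A0 e0.
have A1 : 0 < A + 1 by rewrite ltr_wpDl.
have [||m1 m1P] := @exp_small R rho (e / (A + 1)); [by lra|by rewrite divr_gt0|].
exists (m1 + (Num.truncn T).+1)%N; split.
  apply: (lt_le_trans (truncnS_gt T)).
  apply: (@le_trans _ _ (2 ^+ (Num.truncn T).+1)).
    by rewrite -natrX ler_nat ltnW// ltn_expl.
  by rewrite ler_weXn2l ?leq_addl// ler1n.
rewrite exprD; apply: (@le_lt_trans _ _ (A * rho ^+ m1)).
  by rewrite ler_wpM2l// ler_piMr.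
apply: (@le_lt_trans _ _ ((A + 1) * rho ^+ m1)).
  by rewrite ler_wpM2r// lerDl.
by rewrite mulrC -ltr_pdivlMr.
Qed.

Definition dyadic_floor m t : R := (Num.truncn (t * 2 ^+ m))%:R / 2 ^+ m.

Lemma truncn_pow_lt t m : 0 <= t < 2 ^+ m -> (Num.truncn (t * 2 ^+ m) < 4 ^ m)%N.
Proof.
move=> /andP[t0 tm].
have /truncn_itv/andP[ku _] : 0 <= t * 2 ^+ m by rewrite mulr_ge0// exprn_ge0.
rewrite -(ltr_nat R) (le_lt_trans ku)// natrX -[4%N]/(2 * 2)%N natrM exprMn.
by rewrite ltr_pM2r// exprn_gt0.
Qed.

(** From level [j] to the next the floor stays or moves up by one node, since the index [k] becomes
    [2 * k] or [(2 * k).+1]; this costs at most [C * rho ^+ j.+1]. The factor 9 is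
    [rho / (1 - rho)]. *)
Lemma dyadic_chain C f m i t : 0 <= C -> dyadic_bounded C f -> 0 <= t < 2 ^+ m ->
  `|f (dyadic_floor (m + i) t) - f (dyadic_floor m t)| <=
  9 * C * rho ^+ m * (1 - rho ^+ i).
Proof.
move=> C0 fC tm; have /andP[t0 _] := tm.
elim: i => [|i ih]; first by rewrite addn0 subrr normr0 expr0 subrr mulr0.
set j := (m + i)%N in ih *.
suff step : `|f (dyadic_floor j.+1 t) - f (dyadic_floor j t)| <= C * rho ^+ j.+1.
  rewrite addnS (le_trans (ler_distD (f (dyadic_floor j t)) _ _))//.
  apply: le_trans (lerD step ih) _.
  rewrite /j !exprS exprD.
  by rewrite le_eqVlt; apply/orP; left; apply/eqP; field.
have tj : 0 <= t < 2 ^+ j.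
  rewrite t0/=; case/andP: tm => _ /lt_le_trans; apply.
  by rewrite ler_weXn2l ?leq_addr// ler1n.
have u0 n : 0 <= t * 2 ^+ n by rewrite mulr_ge0// exprn_ge0.
have kj := truncn_pow_lt tj.
rewrite /dyadic_floor; set k := Num.truncn (t * 2 ^+ j) in kj *.
have /andP[k1 k2] : k%:R <= t * 2 ^+ j < k.+1%:R by exact: truncn_itv.
rewrite -[ltRHS]natr1 in k2.
have ek : k%:R / 2 ^+ j = (2 * k)%:R / 2 ^+ j.+1 :> R.
  by rewrite exprS natrM -mulf_div divff ?mul1r.
have e2 : t * 2 ^+ j.+1 = 2 * (t * 2 ^+ j) by rewrite exprS; ring.
have [lt2|ge2] := ltP (t * 2 ^+ j.+1) (2 * k).+1%:R.
  have -> : Num.truncn (t * 2 ^+ j.+1) = (2 * k)%N.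
    by apply: truncn_def; rewrite lt2 andbT e2 natrM ler_pM2l.
  by rewrite -ek subrr normr0 mulr_ge0.
have -> : Num.truncn (t * 2 ^+ j.+1) = (2 * k).+1.
  apply: truncn_def; rewrite ge2/= e2.
  have -> : (2 * k).+2%:R = 2 * (k%:R + 1) :> R.
    by rewrite -[(2 * k).+2]addn2 natrD natrM; ring.
  by rewrite ltr_pM2l.
rewrite ek; apply: fC.
rewrite expnS (leq_trans (_ : 2 * k < 2 * 4 ^ j)%N)// ?ltn_pmul2l//.
by rewrite leq_mul2r orbT.
Qed.

Lemma dyadic_floor_dist m t : 0 <= t ->
  dyadic_floor m t <= t /\ t - dyadic_floor m t < 2 ^- m.
Proof.
move=> t0.
have /truncn_itv/andP[k1 k2] : 0 <= t * 2 ^+ m by rewrite mulr_ge0// exprn_ge0.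
rewrite /dyadic_floor ler_pdivrMr ?exprn_gt0//; split=> //.
rewrite ltrBlDl -[X in _ + X]mul1r -mulrDl natr1.
by rewrite ltr_pdivlMr ?exprn_gt0.
Qed.

(** The floors in [dyadic_chain] tend to [t] as [i] grows, and [f] is continuous. *)
Lemma dyadic_floor_approx C f m t : 0 <= C -> dyadic_bounded C f ->
  {within `[0, +oo[, continuous f} -> 0 <= t < 2 ^+ m ->
  `|f t - f (dyadic_floor m t)| <= 9 * C * rho ^+ m.
Proof.
move=> C0 fC /within_continuousP cf tm; have /andP[t0 _] := tm.
apply/ler_addgt0Pr => e e0.
have [|d d0 dP] := cf t e _ e0; first by rewrite /= in_itv/= t0.
have [||i iP] := @exp_small R 2^-1 d => //.
  by rewrite invr_ge0 ler0n/= invf_lt1// ltr1n.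
have [f1 f2] := dyadic_floor_dist (m + i) t0.
have fl0 : 0 <= dyadic_floor (m + i) t by rewrite divr_ge0// exprn_ge0.
have h : `|f t - f (dyadic_floor (m + i) t)| < e.
  apply: dP; first by rewrite /= in_itv/= fl0.
  rewrite ger0_norm ?subr_ge0// (lt_trans f2)// (le_lt_trans _ iP)//.
  rewrite exprD invfM exprVn ler_piMl ?invr_ge0 ?exprn_ge0//.
  by rewrite invf_le1 ?exprn_gt0// exprn_ege1// ler1n.
rewrite (le_trans (ler_distD (f (dyadic_floor (m + i) t)) _ _))// addrC lerD//.
  apply: le_trans (dyadic_chain i C0 fC tm) _.
  by rewrite ler_piMr ?mulr_ge0// gerBl.
exact: ltW.
Qed.

Lemma dyadic_node_bound C f m k : dyadic_bounded C f -> f 0 = 0 ->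
  (k <= 4 ^ m)%N -> `|f (k%:R / 2 ^+ m)| <= k%:R * (C * rho ^+ m).
Proof.
move=> fC f0; elim: k => [|k ih] km; first by rewrite !mul0r f0 normr0.
apply: (@le_trans _ _ (C * rho ^+ m + k%:R * (C * rho ^+ m))); last first.
  by rewrite -[X in X + _]mul1r -mulrDl nat1r.
rewrite -[f _](subrK (f (k%:R / 2 ^+ m))) (le_trans (ler_normD _ _))//.
by apply: lerD; [exact: fC|apply: ih; exact: ltnW].
Qed.

(** These hypotheses on [f] survive pointwise limits, whereas continuity does not. Two times less
    than [2 ^- m] apart have equal or adjacent floors, which gives 19 = 9 + 1 + 9 times
    [C * rho ^+ m]. *)
Lemma dyadic_continuous C f : 0 <= C -> dyadic_bounded C f ->
  (forall m t, 0 <= t < 2 ^+ m ->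
    `|f t - f (dyadic_floor m t)| <= 9 * C * rho ^+ m) ->
  {within `[0, +oo[, continuous f}.
Proof.
move=> C0 fC fF; apply/within_continuousP => t e /=.
rewrite in_itv/= andbT => t0 e0.
(* The margin 1 keeps the nearby time [s] below [2 ^+ m] too. *)
have [||m [mt me]] := @exists_level (t + 1) (19 * C) e => //.
  by rewrite mulr_ge0.
have p1 : 1 <= 2 ^+ m :> R by rewrite exprn_ege1// ler1n.
have p0 : 0 < 2 ^+ m :> R by rewrite exprn_gt0.
exists (2 ^- m) => [|s /=]; first by rewrite invr_gt0.
rewrite in_itv/= andbT => s0 ts.
have i1 : 2 ^- m <= 1 :> R by rewrite invf_le1.
have tm : 0 <= t < 2 ^+ m by rewrite t0/=; lra.
have sm : 0 <= s < 2 ^+ m.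
  by rewrite s0/=; move: ts; rewrite ltr_norml => /andP[]; lra.
apply: le_lt_trans me.
have -> : 19 * C * rho ^+ m = 9 * C * rho ^+ m + C * rho ^+ m + 9 * C * rho ^+ m.
  by ring.
apply: (le_trans (ler_distD (f (dyadic_floor m s)) _ _)); apply: lerD; last first.
  by rewrite distrC fF.
apply: (le_trans (ler_distD (f (dyadic_floor m t)) _ _)); apply: lerD.
  exact: fF.
have ut := truncn_pow_lt tm; have us := truncn_pow_lt sm.
have /truncn_itv/andP[a1 a2] : 0 <= t * 2 ^+ m by rewrite mulr_ge0// ltW.
have /truncn_itv/andP[b1 b2] : 0 <= s * 2 ^+ m by rewrite mulr_ge0// ltW.
have : `|t * 2 ^+ m - s * 2 ^+ m| < 1.
  by rewrite -mulrBl normrM (gtr0_norm p0) -ltr_pdivlMr// mul1r.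
rewrite /dyadic_floor ltr_norml => /andP[c1 c2].
move: (Num.truncn (t * 2 ^+ m)) (Num.truncn (s * 2 ^+ m)) ut us a1 a2 b1 b2 => k l.
move=> ut us a1 a2 b1 b2.
have kl : (k <= l.+1)%N.
  rewrite -ltnS -(ltr_nat R) -[ltRHS]natr1 -[l.+1%:R]natr1.
  by rewrite -[ltRHS]natr1 in b2; lra.
have lk : (l <= k.+1)%N.
  rewrite -ltnS -(ltr_nat R) -[ltRHS]natr1 -[k.+1%:R]natr1.
  by rewrite -[ltRHS]natr1 in a2; lra.
have [kl'|lk'|->] := ltngtP k l; last by rewrite subrr normr0 mulr_ge0.
  have -> : l = k.+1 by apply/eqP; rewrite eqn_leq lk.
  by rewrite distrC; exact: fC.
have -> : k = l.+1 by apply/eqP; rewrite eqn_leq kl.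
exact: fC.
Qed.

End dyadic_chaining.

(** * Compactness of the sets with a dyadic modulus *)

Section compactness.
Context {R : realType}.
Local Notation rho := (9 / 10 : R).
Implicit Types (C t s : R) (m k i : nat).

Let rho_ge0 m : 0 <= rho ^+ m. Proof. by rewrite exprn_ge0// divr_ge0. Qed.

(** The floor of [t] is joined to 0 by finitely many increments of a single level. *)
Lemma dyadic_modulus_pointwise_bounded C t : 0 <= C ->
  exists M, forall x : Cinfty R, dyadic_modulus_le C x -> `|x t| <= M.
Proof.
move=> C0; have [t0|t0] := ltP t 0.
  exists 0 => x _; rewrite path_out ?normr0//=.
  by rewrite in_itv/= andbT leNgt t0.
have [||m [mt _]] := @exists_level R t 0 1 => //.
have tm : 0 <= t < 2 ^+ m by rewrite t0.
exists (9 * C * rho ^+ m + (Num.truncn (t * 2 ^+ m))%:R * (C * rho ^+ m)) => x xC.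
rewrite -[x t](subrK (x (dyadic_floor m t))) (le_trans (ler_normD _ _))// lerD//.
  by apply: dyadic_floor_approx => //; exact: path_continuous.
apply: dyadic_node_bound => //; first exact: path_at0.
exact/ltnW/truncn_pow_lt.
Qed.

(* The limit along an ultrafilter is taken pointwise; the common modulus makes
   it continuous and turns pointwise convergence into convergence in the
   metric. *)
Lemma compact_dyadic_modulus C : 0 <= C ->
  compact (dyadic_modulus_le C : set (Cinfty R)).
Proof.
move=> C0; rewrite compact_ultra => F UF FK.
have PF : ProperFilter F by exact: ultra_proper.
have lim_t t : exists l : R, (fun x : Cinfty R => x t) @ F --> l.
  have [M MP] := dyadic_modulus_pointwise_bounded t C0.
  have PG : ProperFilter ((fun x : Cinfty R => x t) @ F).
    exact: fmap_proper_filter.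
  have [|l [_ cl]] := @segment_compact R (- M) M _ PG.
    suff : F ((fun x : Cinfty R => x t) @^-1` `[- M, M]) by [].
    apply: (filterS _ FK) => x /MP; rewrite ler_norml => /andP[xM Mx] /=.
    by rewrite in_itv/= xM.
  exists l => U Ul /=.
  have [//|FU] := in_ultra_setVsetC ((fun x : Cinfty R => x t) @^-1` U) UF.
  by have [y [nUy Uy]] := cl (~` U) U FU Ul.
pose g t := xget 0 [set l | (fun x : Cinfty R => x t) @ F --> l].
have gP t : (fun x : Cinfty R => x t) @ F --> g t.
  exact: (xgetPex 0 (lim_t t)).
have near_g t e : 0 < e -> \forall x \near F, `|g t - (x : Cinfty R) t| < e.
  by move=> e0; have /cvgrPdist_lt := gP t; exact.
(* Uniform bounds on the difference of two values pass to the limit [g], in particular the dyadic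
   modulus and the distance to the floor. *)
have g_le t s M : (forall x, dyadic_modulus_le C x -> `|x t - x s| <= M) ->
    `|g t - g s| <= M.
  move=> xM; apply/ler_addgt0Pr => e e0.
  have e20 : 0 < e / 2 by rewrite divr_gt0.
  have /filter_ex[x [[xt xs] /xM xM']] :
      F ((([set x : Cinfty R | `|g t - x t| < e / 2] `&`
          [set x : Cinfty R | `|g s - x s| < e / 2])) `&` dyadic_modulus_le C).
    by apply: filterI => //; apply: filterI; exact: near_g.
  move: xt xs xM' => /=.
  have := ler_distD (x t) (g t) (g s); have := ler_distD (x s) (x t) (g s).
  by rewrite (distrC (x s) (g s)); lra.
have gC : dyadic_bounded C g by move=> m k km; apply: g_le => x; exact.
have gF m t : 0 <= t < 2 ^+ m -> `|g t - g (dyadic_floor m t)| <= 9 * C * rho ^+ m.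
  move=> tm; apply: g_le => x xC; apply: dyadic_floor_approx => //.
  exact: path_continuous.
have gout t : (forall x : Cinfty R, x t = 0) -> g t = 0.
  move=> xt; apply/eqP; rewrite -normr_le0; apply/ler_addgt0Pr => e e0.
  have /filter_ex[x /=] := near_g t e e0.
  by rewrite xt subr0 add0r => /ltW.
have cg := dyadic_continuous C0 gC gF.
have g0 : g 0 = 0 by apply: gout => x; exact: path_at0.
have go t : ~ `[0, +oo[%classic t -> g t = 0.
  by move=> nt; apply: gout => x; exact: path_out.
exists (PathOn cg g0 go); split; first exact: gC.
apply/cvg_ballP => e e0.
have [N NP] : exists N, 2^-1 ^+ N < e / 2.
  by apply: exp_small; rewrite ?divr_gt0// invr_ge0 ler0n/= invf_lt1// ltr1n.
have e40 : 0 < e / 4 by rewrite divr_gt0.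
(* Both [g] and [x] are within [9 * C * rho ^+ m] of their values at the floor. With [e / 8] at the
   node this gives at most [e / 4] on [[0, N]], and the tail [2^-1 ^+ N] is below [e / 2]. *)
have [||m [Nm me]] := @exists_level R N%:R (18 * C) (e / 8) => //.
  by rewrite mulr_ge0.
  by rewrite divr_gt0.
have nearnodes : \forall x \near F, forall k : 'I_(4 ^ m),
    `|g (k%:R / 2 ^+ m) - (x : Cinfty R) (k%:R / 2 ^+ m)| < e / 8.
  by apply: filter_forall => k; apply: near_g; rewrite divr_gt0.
near=> x.
have xC : dyadic_modulus_le C x by near: x.
have xk : forall k : 'I_(4 ^ m),
    `|g (k%:R / 2 ^+ m) - (x : Cinfty R) (k%:R / 2 ^+ m)| < e / 8 by near: x.
rewrite ball_Cinfty/=.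
have le4 : sup_dist N%:R (PathOn cg g0 go : Cinfty R) x <= e / 4.
  apply: sup_dist_le => [|t /andP[t0 tN] /=]; first exact: ltW.
  have tm : 0 <= t < 2 ^+ m by rewrite t0 (le_lt_trans tN).
  have kx := xk (Ordinal (truncn_pow_lt tm)).
  have gx : `|g t - g (dyadic_floor m t)| <= 9 * C * rho ^+ m by exact: gF.
  have xx : `|x t - x (dyadic_floor m t)| <= 9 * C * rho ^+ m.
    by apply: dyadic_floor_approx => //; exact: path_continuous.
  rewrite /= -/(dyadic_floor m t) in kx.
  have := ler_distD (g (dyadic_floor m t)) (g t) (x t).
  have := ler_distD (x (dyadic_floor m t)) (g (dyadic_floor m t)) (x t).
  by rewrite (distrC (x (dyadic_floor m t)) (x t)); lra.
by apply: le_lt_trans (Cinfty_dist_le le4) _; lra.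
Unshelve. all: by end_near. Qed.

End compactness.

(** * Regularity and compact images *)

Section regularity.
Context {R : realType} (X : topologicalType) d (T : measurableType d).
Variables (f : X -> T) (mu : probability T R).
Implicit Types (B F U : set T).

(** Regularity of [mu], with closed and open read in [X] through [f] since [T] carries only a
    sigma-algebra. The map [f] is later a map of increments, then the identity of the path space. *)
Definition sandwiched B := measurable B /\ forall e : R, 0 < e ->
  exists F U, [/\ measurable F, measurable U, closed (f @^-1` F),
    open (f @^-1` U) & [/\ F `<=` B, B `<=` U & (mu (U `\` F) <= e%:E)%E]].

Lemma sandwiched_setC B : sandwiched B -> sandwiched (~` B).
Proof.
move=> [mB Be]; split=> [|e e0]; first exact: measurableC.
have [F [U [mF mU cF oU [FB BU UF]]]] := Be e e0.
exists (~` U), (~` F); split.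
- exact: measurableC.
- exact: measurableC.
- by rewrite preimage_setC; exact: open_closedC.
- by rewrite preimage_setC; exact: closed_openC.
split; [exact: subsetC|exact: subsetC|].
by rewrite setDE setCK setIC -setDE.
Qed.

(** Countable unions of closed sets are not closed in general, so only finitely many sets can be
    kept; continuity from above bounds the loss. *)
Lemma finite_union_approx U (F : (set T)^nat) (e : R) : measurable U ->
  (forall n, measurable (F n)) -> (mu (U `\` \bigcup_n F n) < e%:E)%E ->
  exists n, (mu (U `\` \bigcup_(i < n) F i) <= e%:E)%E.
Proof.
move=> mU mF UFe.
have mFn n : measurable (\bigcup_(i < n) F i) by exact: bigcup_measurable.
have mFF : measurable (\bigcup_n F n) by exact: bigcupT_measurable.
have capUF : \bigcap_n (U `\` \bigcup_(i < n) F i) = U `\` \bigcup_n F n.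
  apply/seteqP; split=> [x UFx|x [Ux nFx] n _].
    split=> [|[n _ Fnx]]; first by case: (UFx 0%N I).
    by have [_] := UFx n.+1 I; apply; exists n => /=.
  by split=> // -[i _ Fix]; apply: nFx; exists i.
have cvgUF : mu (U `\` \bigcup_(i < n) F i) @[n --> \oo] -->
    mu (U `\` \bigcup_n F n).
  rewrite -capUF.
  apply: (@nonincreasing_cvg_mu _ _ _ mu (fun n => U `\` \bigcup_(i < n) F i)).
  - by rewrite (le_lt_trans (probability_le1 _ _)) ?ltry//; exact: measurableD.
  - by move=> n; exact: measurableD.
  - by rewrite capUF; exact: measurableD.
  - move=> n m nm; apply/subsetPset => x [Ux nFx]; split=> // -[i /= im Fx].
    by apply: nFx; exists i => //=; exact: leq_trans nm.
have /cvgUF[n _ nP] := open_ereal_lt' UFe.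
by exists n; apply/ltW; exact: (nP n (leqnn n)).
Qed.

Lemma sandwiched_open U (F : (set T)^nat) : measurable U -> open (f @^-1` U) ->
  (forall n, measurable (F n)) -> (forall n, closed (f @^-1` (F n))) ->
  U = \bigcup_n F n -> sandwiched U.
Proof.
move=> mU oU mF cF UF; split=> // e e0.
have [|n UFn] := @finite_union_approx U F e mU mF.
  by rewrite -UF setDv measure0 lte_fin.
exists (\bigcup_(i < n) F i), U; split => //.
- exact: bigcup_measurable.
- by rewrite preimage_bigcup bigcup_mkord; apply: closed_bigsetU => i _; exact: cF.
- by split => //; rewrite UF => x [i _ Fx]; exists i.
Qed.

(** All the outer sets are united, the inner ones only up to a finite index. The gaps sum to at most
    [e / 2], which leaves room for the truncation. *)
Lemma sandwiched_bigcup (B : (set T)^nat) : (forall n, sandwiched (B n)) ->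
  sandwiched (\bigcup_n B n).
Proof.
move=> aB; have mB n : measurable (B n) by case: (aB n).
split=> [|e e0]; first exact: bigcupT_measurable.
have e20 : 0 < e / 2 by rewrite divr_gt0.
have /choice[FU FUP] : forall n, exists FU : set T * set T,
    [/\ measurable FU.1, measurable FU.2, closed (f @^-1` FU.1),
    open (f @^-1` FU.2) & [/\ FU.1 `<=` B n, B n `<=` FU.2 &
    (mu (FU.2 `\` FU.1) <= (e / 2 / (2 ^ n.+1)%:R)%:E)%E]].
  move=> n; have [_ /(_ (e / 2 / (2 ^ n.+1)%:R))[|F [U FUP]]] := aB n.
    by rewrite divr_gt0// ltr0n expn_gt0.
  by exists (F, U).
have mF i : measurable (FU i).1 by case: (FUP i).
have mU i : measurable (FU i).2 by case: (FUP i).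
pose U := \bigcup_n (FU n).2.
have mUU : measurable U by exact: bigcupT_measurable.
have mFF : measurable (\bigcup_n (FU n).1) by exact: bigcupT_measurable.
have [|n UFn] := @finite_union_approx U (fun n => (FU n).1) e mUU mF.
  apply: (@le_lt_trans _ _ (e / 2)%:E); last first.
    by rewrite lte_fin ltr_pdivrMr// ltr_pMr// ltr1n.
  apply: (@le_trans _ _ (\sum_(0 <= n <oo) mu ((FU n).2 `\` (FU n).1))%E).
    apply: measure_sigma_subadditive.
    - by move=> n; exact: measurableD.
    - exact: measurableD.
    - move=> x [[n _ Ux] nF]; exists n => //; split => // Fx.
      by apply: nF; exists n.
  apply: le_trans (epsilon_trick0 xpredT (ltW e20)).
  by apply: lee_nneseries => // n _; have [_ _ _ _ [_ _]] := FUP n.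
exists (\bigcup_(i < n) (FU i).1), U; split => //.
- exact: bigcup_measurable.
- rewrite preimage_bigcup bigcup_mkord.
  by apply: closed_bigsetU => i _; case: (FUP i).
- by rewrite preimage_bigcup; apply: bigcup_open => i _; case: (FUP i).
split => //.
- by move=> x [i _ Fx]; exists i => //; case: (FUP i) => _ _ _ _ [+ _ _]; exact.
- by move=> x [i _ Bx]; exists i => //; case: (FUP i) => _ _ _ _ [_ + _]; exact.
Qed.

Lemma sandwiched_sigma_algebra : sigma_algebra setT sandwiched.
Proof.
split.
- split=> // e e0; exists set0, set0; split=> //.
  + by rewrite preimage_set0; exact: closed0.
  + by rewrite preimage_set0; exact: open0.
  + by split=> //; rewrite setD0 measure0 lee_fin ltW.
- by move=> A /sandwiched_setC; rewrite setTD.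
- exact: sandwiched_bigcup.
Qed.

End regularity.

(** * Measurable images of compact sets *)

Section compact_images.
Context {R : realType} {X : topologicalType}.
Local Notation RR := (measurableTypeR R).
Implicit Types K : set X.

(** [y] is a cluster point of the sequence. No subsequence is extracted: a continuous functional
    that converges along the whole sequence takes its limit at [y]. *)
Lemma compact_cluster_seq K (x : nat -> X) : compact K -> (forall n, K (x n)) ->
  exists2 y, K y & forall (g : X -> R) (c : R), continuous g ->
    g (x n) @[n --> \oo] --> c -> g y = c.
Proof.
move=> cK Kx.
have FK : (x @ \oo) K by exists 0%N => // n _; exact: Kx.
have [y [Ky cly]] := cK (x @ \oo) (fmap_proper_filter x _) FK.
exists y => // g c cg gc; apply/eqP; rewrite -subr_eq0 -normr_le0.
apply/ler_addgt0Pr => e e0; rewrite add0r.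
have e20 : 0 < e / 2 by rewrite divr_gt0.
have [z [zx zy]] : [set z | `|c - g z| < e / 2] `&`
    [set z | `|g y - g z| < e / 2] !=set0.
  apply: cly; first by have /cvgrPdist_lt/(_ _ e20) := gc.
  by have /(cvgrPdist_lt (FF := nbhs_filter y))/(_ _ e20) := cg y.
move: zx zy => /=; have := ler_distD (g z) (g y) c.
by rewrite (distrC (g z) c); lra.
Qed.

(** The image is the intersection over [n] of the countable unions of the boxes of side [2 ^- n]
    that meet it. A tuple in all of them is a limit of images of points of [K], hence the image of a
    cluster point. *)
Lemma measurable_compact_image K N (f : X -> N.-tuple RR) : compact K ->
  (forall i, continuous (fun x => tnth (f x) i : R)) -> measurable (f @` K).
Proof.
move=> cK cf.
pose box n (c : N.-tuple int) : set (N.-tuple RR) :=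
  [set w | forall i, (tnth c i)%:~R <= tnth w i * 2 ^+ n < (tnth c i)%:~R + 1].
pose E n (c : N.-tuple int) :=
  if pselect (box n c `&` f @` K !=set0) then box n c else set0.
have mbox n c : measurable (box n c).
  rewrite (_ : box n c = \big[setI/setT]_(i < N) ((@tnth N RR)^~ i @^-1`
      [set y : RR | (tnth c i)%:~R <= y * 2 ^+ n < (tnth c i)%:~R + 1])).
    apply: bigsetI_measurable => i _.
    rewrite -[X in measurable X]setTI; apply: measurable_tnth => //.
    rewrite (_ : [set _ | _] = `[((tnth c i)%:~R / 2 ^+ n),
        (((tnth c i)%:~R + 1) / 2 ^+ n)[%classic); first exact: measurable_itv.
    apply/seteqP; split => y /=; rewrite in_itv/=;
      by rewrite ler_pdivrMr ?exprn_gt0// ltr_pdivlMr ?exprn_gt0.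
  rewrite -bigcap_seq; apply/seteqP; split => [w Bw i _|w Bw i]; first exact: Bw.
  by apply: Bw => /=; rewrite mem_index_enum.
rewrite (_ : f @` K = \bigcap_n \bigcup_c E n c).
  apply: bigcapT_measurable => n; apply: countable_bigcupT_measurable.
    exact: countableP.
  by move=> c; rewrite /E; case: pselect => _ /=; [exact: mbox|exact: measurable0].
apply/seteqP; split=> [_ [x Kx <-] n _|w Ew].
  exists [tuple Num.floor (tnth (f x) i * 2 ^+ n) | i < N] => //.
  have bx : box n [tuple Num.floor (tnth (f x) i * 2 ^+ n) | i < N] (f x).
    move=> i; rewrite tnth_mktuple -[X in _ + X]/(1%:~R) -intrD.
    by rewrite floor_itv// num_real.
  by rewrite /E; case: pselect => // -[]; exists (f x); split => //; exists x.
have /choice[x xP] : forall n, exists x, K x /\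
    forall i, `|tnth w i - tnth (f x) i| <= 2^-1 ^+ n.
  move=> n; have [c _] := Ew n I; rewrite /E; case: pselect => // ne /= bw.
  have [z [bx [x Kx fx]]] := ne; rewrite -{}fx in bx.
  exists x; split=> // i; have := bx i; have := bw i.
  have p0 : 0 < 2 ^+ n :> R by rewrite exprn_gt0.
  move=> /andP[w1 w2] /andP[x1 x2].
  rewrite exprVn -[leRHS]mul1r ler_pdivlMr// -[X in _ * X](gtr0_norm p0) -normrM.
  by rewrite mulrBl ler_norml; lra.
have [y Ky yP] := compact_cluster_seq cK (fun n => (xP n).1).
exists y => //; apply: eq_from_tnth => i.
apply: (yP (fun z => tnth (f z) i : R) _ (cf i)).
apply/cvgrPdist_le => e e0.
have /cvg_expr/cvgrPdist_lt/(_ _ e0) : `|2^-1 : R| < 1.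
  by rewrite ger0_norm ?invr_ge0// invf_lt1// ltr1n.
apply: filterS => n; rewrite sub0r normrN => en.
apply: le_trans ((xP n).2 i) _; apply: le_trans (ltW en); exact: ler_norm.
Qed.

End compact_images.

(** * The measure on the space of paths *)

Section cylinders.
Context {R : realType}.
Local Notation RR := (measurableTypeR R).
Implicit Types (n m : nat).

Lemma dyadic_increments_onto n (v : (4 ^ n).-tuple RR) :
  exists x : Cinfty R, dyadic_increments n x = v.
Proof. by exists (interp_path v); exact: dyadic_increments_interp. Qed.

Lemma continuous_dyadic_increments n i :
  continuous (fun x : Cinfty R => tnth (dyadic_increments n x) i : R).
Proof.
rewrite (_ : (fun _ => _) = fun x : Cinfty R =>
  x (i.+1%:R / 2 ^+ n) - x (i%:R / 2 ^+ n)).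
  move=> x; apply: (@cvgB _ R _ (nbhs x)); exact: continuous_Cinfty_eval.
by apply/funext => x; rewrite tnth_mktuple.
Qed.

(** The sandwiched sets form a sigma-algebra, so coordinate preimages of open rays suffice; such a
    ray is a countable union of closed rays. *)
Lemma dyadic_increments_sandwiched n (B : set ((4 ^ n).-tuple RR)) :
  measurable B -> sandwiched (@dyadic_increments R n) (dyadic_law n) B.
Proof.
set S := sandwiched _ _.
have [S0 SC SU] : sigma_algebra setT S by exact: sandwiched_sigma_algebra.
move: B; apply: smallest_sub; first by split.
rewrite -bigcup_seq => _ [i _ [A mA <-]]; rewrite setTI.
suff : measurable `<=` [set A | S ((@tnth (4 ^ n) RR)^~ i @^-1` A)] by exact.
rewrite RGenOInfty.measurableE; apply: smallest_sub.
  split => [|D SD|D SD] /=.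
  - by rewrite preimage_set0.
  - by rewrite setTD preimage_setC -setTD; exact: SC.
  - by rewrite preimage_bigcup; exact: SU.
move=> _ [c ->] /=.
have mtn (D : set RR) : measurable D ->
    measurable ((@tnth (4 ^ n) RR)^~ i @^-1` D).
  by move=> mD; rewrite -[X in measurable X]setTI; exact: measurable_tnth.
apply: (@sandwiched_open _ _ _ _ _ _ _
    (fun k => (@tnth (4 ^ n) RR)^~ i @^-1` `[c + k.+1%:R^-1, +oo[%classic)).
- by apply: mtn; exact: measurable_itv.
- rewrite -comp_preimage; apply: (@open_comp _ _ (fun x : Cinfty R =>
    tnth (dyadic_increments n x) i : R)).
    by move=> x _; exact: continuous_dyadic_increments.
  exact: interval_open.
- by move=> k; apply: mtn; exact: measurable_itv.
- move=> k; rewrite -comp_preimage.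
  apply: (closed_comp (f := fun x : Cinfty R =>
    tnth (dyadic_increments n x) i : R)).
    by move=> x _; exact: continuous_dyadic_increments.
  exact: interval_closed.
- rewrite -preimage_bigcup; congr (_ @^-1` _).
  by rewrite itvoyEbigcup.
Qed.

Definition cylinder : set (set (Cinfty R)) := [set A | exists n B,
  measurable B /\ A = dyadic_increments n @^-1` B].

Lemma preimage_dyadic_coarsen m n (B : set ((4 ^ m).-tuple RR)) : (m <= n)%N ->
  @dyadic_increments R m @^-1` B =
  dyadic_increments n @^-1` (block_sums (2 ^ (n - m)) 0 (4 ^ m) @^-1` B).
Proof.
by move=> mn; apply/seteqP; split => x /=;
  rewrite (dyadic_increments_coarsen x mn).
Qed.

Lemma measurable_preimage_block_sums p q M N (B : set (M.-tuple RR)) :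
  measurable B -> measurable (@block_sums R p q M N @^-1` B).
Proof.
by move=> mB; rewrite -[X in measurable X]setTI; exact: measurable_block_sums.
Qed.

Lemma cylinder_common_level A B : cylinder A -> cylinder B -> exists n A' B',
  [/\ measurable A', measurable B', A = dyadic_increments n @^-1` A' &
      B = dyadic_increments n @^-1` B'].
Proof.
move=> [m [A' [mA' ->]]] [n [B' [mB' ->]]].
exists (maxn m n), (block_sums (2 ^ (maxn m n - m)) 0 (4 ^ m) @^-1` A'),
  (block_sums (2 ^ (maxn m n - n)) 0 (4 ^ n) @^-1` B'); split.
- exact: measurable_preimage_block_sums.
- exact: measurable_preimage_block_sums.
- by rewrite -preimage_dyadic_coarsen// leq_maxl.
- by rewrite -preimage_dyadic_coarsen// leq_maxr.
Qed.

Lemma cylinder0 : cylinder set0.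
Proof. by exists 0%N, set0; rewrite preimage_set0. Qed.

Lemma cylinderU : setU_closed cylinder.
Proof.
move=> A B /cylinder_common_level /[apply] -[n [A' [B' [mA mB -> ->]]]].
by exists n, (A' `|` B'); rewrite preimage_setU; split=> //; exact: measurableU.
Qed.

Lemma cylinderC : setC_closed cylinder.
Proof.
move=> A [n [B [mB ->]]].
by exists n, (~` B); rewrite preimage_setC; split=> //; exact: measurableC.
Qed.

(** A separate name for the path space, so that its measurable sets are the cylinders, which are
    only given as an algebra. *)
Definition cylinder_type : Type := Cinfty R.

HB.instance Definition _ := Pointed.copy cylinder_type (Cinfty R).
HB.instance Definition _ := isAlgebraOfSets.Build default_measure_display
  cylinder_type cylinder0 cylinderU cylinderC.

(* On a cylinder the infimum is over a singleton, see [cylinder_contentE];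
   elsewhere it is [+oo]. *)
Definition cylinder_content (A : set cylinder_type) : \bar R :=
  ereal_inf [set z | exists n (B : set ((4 ^ n).-tuple RR)),
    [/\ measurable B, A = dyadic_increments n @^-1` B & z = dyadic_law n B]].

(** Two representations are compared at the finer level, where surjectivity of the increments
    recovers the base from the cylinder. *)
Lemma cylinder_contentE n (B : set ((4 ^ n).-tuple RR)) : measurable B ->
  cylinder_content (dyadic_increments n @^-1` B) = dyadic_law n B.
Proof.
have le_eq k l (C : set ((4 ^ k).-tuple RR)) (D : set ((4 ^ l).-tuple RR)) :
    (k <= l)%N -> measurable C -> dyadic_increments k @^-1` C =
    @dyadic_increments R l @^-1` D -> dyadic_law k C = dyadic_law l D.
  move=> kl mC CD; rewrite -(dyadic_law_coarsen kl mC); congr (dyadic_law l _).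
  move: CD; rewrite (preimage_dyadic_coarsen _ kl) => CD.
  apply/seteqP; split => v; have [x <-] := dyadic_increments_onto v;
    by move: (congr1 (@^~ x) CD) => /= ->.
move=> mB; rewrite /cylinder_content.
rewrite [X in ereal_inf X](_ : _ = [set dyadic_law n B]).
  by rewrite ereal_inf1.
apply/seteqP; split => [_ [m [C [mC BC ->]]]|_ ->] /=; last by exists n, B.
by have [mn|/ltnW nm] := leqP m n; [exact: le_eq|apply/esym; exact: le_eq].
Qed.

Let content0 : cylinder_content set0 = 0%E.
Proof.
by rewrite -(preimage_set0 (@dyadic_increments R 0)) cylinder_contentE// measure0.
Qed.

Lemma cylinder_contentT : cylinder_content setT = 1%E.
Proof.
rewrite -(preimage_setT (@dyadic_increments R 0)) cylinder_contentE//.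
exact: probability_setT.
Qed.

Let content_ge0 A : (0 <= cylinder_content A)%E.
Proof. by apply: le_ereal_inf_tmp => _ [n [B [_ _ ->]]]. Qed.

Let content_semi_additive : measure_function.semi_additive cylinder_content.
Proof.
apply/additive2P => // A B mA mB AB.
have [n [A' [B' [mA' mB' AE BE]]]] := cylinder_common_level mA mB.
rewrite AE BE -preimage_setU !cylinder_contentE//; last exact: measurableU.
(* Disjoint cylinders have disjoint bases, again by surjectivity. *)
rewrite measureU//; apply/seteqP; split => // v [A'v B'v].
have [x xv] := dyadic_increments_onto v.
suff : (A `&` B) x by rewrite AB.
by rewrite AE BE /= xv.
Qed.

HB.instance Definition _ := isContent.Build _ cylinder_type R cylinder_content
  content_ge0 content_semi_additive.

Lemma cylinder_content_concentrated (C : R) (A : set cylinder_type) : 1 <= C ->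
  measurable A -> dyadic_modulus_le C `<=` A ->
  (1 - (120 * 4 ^+ 4 / C)%:E <= cylinder_content A)%E.
Proof.
move=> C1 [n [B [mB ->]]] CB; rewrite cylinder_contentE//.
exact: dyadic_law_concentrated.
Qed.

Lemma cylinder_content_le1 (A : set cylinder_type) : measurable A ->
  (cylinder_content A <= 1)%E.
Proof.
by move=> [n [B [mB ->]]]; rewrite cylinder_contentE//; exact: probability_le1.
Qed.

Lemma cylinder_sandwich (A : set cylinder_type) (e : R) : measurable A -> 0 < e ->
  exists F U : set cylinder_type, [/\ measurable F, measurable U,
    closed (F : set (Cinfty R)), open (U : set (Cinfty R)) &
    [/\ F `<=` A, A `<=` U,
    (cylinder_content A <= cylinder_content F + e%:E)%E &
    (cylinder_content U <= cylinder_content A + e%:E)%E]].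
Proof.
move=> [n [B [mB ->]]] e0.
have [_ /(_ e e0)[F [U [mF mU cF oU [FB BU UF]]]]] :=
  dyadic_increments_sandwiched mB.
exists (dyadic_increments n @^-1` F), (dyadic_increments n @^-1` U).
rewrite !cylinder_contentE//.
have mUF : measurable (U `\` F) by exact: measurableD.
have UFE : U = F `|` (U `\` F) by rewrite setDUK//; exact: subset_trans BU.
have leU : (dyadic_law n U <= dyadic_law n F + e%:E)%E.
  by rewrite {1}UFE (le_trans (measureU2 _ _ _))// leeD2l.
split=> //; first by exists n, F.
  by exists n, U.
split => //.
- by move=> x /= /FB.
- by move=> x /= /BU.
- by apply: le_trans leU; apply: le_measure; rewrite ?inE.
- by apply: (le_trans leU); apply: leeD => //; apply: le_measure; rewrite ?inE.
Qed.

(** Up to small content, [A] is a closed cylinder [G] and each [F n] an open cylinder [U n].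
    Finitely many [U n], with union [V], cover the compact set of paths of [G] with modulus [C]. The
    union of [V] and the complement of [G] is then a cylinder that contains all paths with this
    modulus, so its content is nearly 1. Each of the three errors is [e / 3]. *)
Lemma cylinder_content_sigma_subadditive :
  measurable_subset_sigma_subadditive cylinder_content.
Proof.
move=> A F mF mA AF; set S := (\sum_(n <oo) _)%E.
apply/lee_addgt0Pr => e e0.
have e30 : 0 < e / 3 by rewrite divr_gt0.
(* This makes the exceptional content at most [e / 3], and the summand 1 ensures [1 <= C]. *)
pose C : R := 1 + 120 * 4 ^+ 4 / (e / 3).
have C1 : 1 <= C by rewrite lerDl divr_ge0 ?ltW// mulr_ge0// exprn_ge0.
have C0 : 0 < C by rewrite (lt_le_trans _ C1).
have Ce : 120 * 4 ^+ 4 / C <= e / 3.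
  by rewrite ler_pdivrMr// [leRHS]mulrC -ler_pdivrMr// lerDr.
have [G [_ [mG _ cG _ [GA _ AG _]]]] := cylinder_sandwich mA e30.
have /choice[U UP] n : exists U : set cylinder_type, [/\ measurable U,
    open (U : set (Cinfty R)), F n `<=` U &
    (cylinder_content U <= cylinder_content (F n) + (e / 3 / (2 ^ n.+1)%:R)%:E)%E].
  have [|_ [U [_ mU _ oU [_ FU _ UF]]]] :=
      @cylinder_sandwich (F n) (e / 3 / (2 ^ n.+1)%:R) (mF n).
    by rewrite divr_gt0// ltr0n expn_gt0.
  by exists U.
have mU n : measurable (U n) by case: (UP n).
have cK : compact ((dyadic_modulus_le C : set (Cinfty R)) `&` G).
  by apply: compact_closedI => //; apply: compact_dyadic_modulus; exact: ltW.
have [N KU] : exists N, dyadic_modulus_le C `&` G `<=` \big[setU/set0]_(i < N) U i.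
  move: cK; rewrite compact_cover => /(_ nat setT U).
  case=> [n _|x [_ /GA/AF[n _ Fx]]|D _ KD].
  - by case: (UP n).
  - by exists n => //; have [_ _ + _] := UP n; exact.
  exists (\max_(i <- finmap.enum_fset D) i).+1 => x /KD[i /= iD Ux].
  by rewrite -bigcup_mkord; exists i => //=; rewrite ltnS leq_bigmax_seq.
pose V : set cylinder_type := \big[setU/set0]_(i < N) U i.
have mV : measurable V by exact: bigsetU_measurable.
have mGC : measurable (~` G) by exact: measurableC.
have le1 : ((1 - e / 3)%:E <= cylinder_content (~` G) + cylinder_content V)%E.
  apply: (@le_trans _ _ (cylinder_content (~` G `|` V))); last exact: measureU2.
  apply: (@le_trans _ _ (1 - (120 * 4 ^+ 4 / C)%:E)%E).
    by rewrite EFinB leeB// lee_fin.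
  apply: cylinder_content_concentrated => //; first exact: measurableU.
  move=> x Cx; have [Gx|nGx] := pselect (G x); last by left.
  by right; exact: KU.
have VS : (cylinder_content V <= S + (e / 3)%:E)%E.
  have := @Boole_inequality _ _ _ cylinder_content U N (fun i _ => mU i).
  move=> /le_trans; apply.
  apply: (@le_trans _ _ (\sum_(0 <= n <oo)
      (cylinder_content (F n) + (e / 3 / (2 ^ n.+1)%:R)%:E))%E); last first.
    by apply: epsilon_trick => //; exact: ltW.
  apply: (@le_trans _ _ (\sum_(0 <= i < N)
      (cylinder_content (F i) + (e / 3 / (2 ^ i.+1)%:R)%:E))%E).
    by rewrite big_mkord; apply: lee_sum => i _; case: (UP i).
  by apply: nneseries_lim_ge => n _ _; rewrite adde_ge0// lee_fin divr_ge0// ltW.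
have GG : (cylinder_content G + cylinder_content (~` G) = 1)%E.
  by rewrite -cylinder_contentT -(setUv G) measureU// setICr.
have fin_le1 (z : \bar R) : (0 <= z -> z <= 1 -> z \is a fin_num)%E.
  by move=> z0 z1; rewrite ge0_fin_numE// (le_lt_trans z1) ?ltry.
have fG : cylinder_content G \is a fin_num.
  by apply: fin_le1 => //; exact: cylinder_content_le1.
have fGC : cylinder_content (~` G) \is a fin_num.
  by apply: fin_le1 => //; exact: cylinder_content_le1.
apply: (le_trans AG).
have S0 : (0 <= S)%E by apply: nneseries_ge0.
have [Soo|Soo] := eqVneq S +oo%E; first by rewrite Soo leey.
have fS : S \is a fin_num by rewrite ge0_fin_numE// lt_neqAle Soo leey.
have fV : cylinder_content V \is a fin_num.
  by apply: fin_le1 => //; exact: cylinder_content_le1.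
move: le1 VS GG; rewrite -(fineK fG) -(fineK fGC) -(fineK fS) -(fineK fV).
rewrite -!EFinD !lee_fin => h1 h2 [h3]; lra.
Qed.

HB.instance Definition _ := Content_SigmaSubAdditive_isMeasure.Build _ R
  cylinder_type cylinder_content cylinder_content_sigma_subadditive.

End cylinders.

(** * Paths determined by their values at the nodes *)

Section nodes.
Context {R : realType}.

(** The floors of [t / a] give nodes below [t] and arbitrarily close to it; they stay in [I], which
    is closed downwards. *)
Lemma path_eq_on_nodes (I : set R) (a : R) (x y : path_on I) : 0 < a ->
  (forall t, I t -> 0 <= t) -> (forall s t, I t -> 0 <= s <= t -> I s) ->
  (forall n k, I (a * k%:R / 2 ^+ n) ->
    x (a * k%:R / 2 ^+ n) = y (a * k%:R / 2 ^+ n)) -> x = y.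
Proof.
move=> a0 I0 Idown xy; apply: path_onP => t It; have t0 := I0 t It.
apply/eqP; rewrite -subr_eq0 -normr_le0; apply/ler_addgt0Pr => e e0.
have e20 : 0 < e / 2 by rewrite divr_gt0.
have [d1 d10 d1P] :=
  (within_continuousP _ _).1 (@path_continuous R I x) t _ It e20.
have [d2 d20 d2P] :=
  (within_continuousP _ _).1 (@path_continuous R I y) t _ It e20.
have dmin0 : 0 < Num.min d1 d2 / a by rewrite divr_gt0// lt_min d10.
have [|m mP] := @exp_small R 2^-1 _ _ dmin0.
  by rewrite invr_ge0 ler0n/= invf_lt1// ltr1n.
have ta0 : 0 <= t / a by rewrite divr_ge0// ltW.
have [f1 f2] := dyadic_floor_dist m ta0.
have f0 : 0 <= dyadic_floor m (t / a) by rewrite divr_ge0// exprn_ge0.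
pose k := Num.truncn (t / a * 2 ^+ m); pose s := a * k%:R / 2 ^+ m.
have sE : s = a * dyadic_floor m (t / a) by rewrite /s -mulrA.
have s0 : 0 <= s by rewrite sE mulr_ge0// ltW.
have st : s <= t by rewrite sE mulrC -ler_pdivlMr.
have Is : I s by apply: (Idown _ t) => //; rewrite s0.
have ts : `|t - s| < Num.min d1 d2.
  rewrite ger0_norm ?subr_ge0// sE.
  have -> : t - a * dyadic_floor m (t / a) = (t / a - dyadic_floor m (t / a)) * a.
    by rewrite mulrBl divfK ?gt_eqF// mulrC.
  by rewrite exprVn in mP; rewrite -ltr_pdivlMr// (lt_trans f2).
move: ts; rewrite lt_min => /andP[ts1 ts2].
have := d1P s Is ts1; have := d2P s Is ts2.
rewrite (xy m k Is) -/s add0r.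
have := ler_distD (y s) (x t) (y t); rewrite (distrC (y s) (y t)); lra.
Qed.

Lemma dyadic_increments_nodes n (x y : Cinfty R) k : (k <= 4 ^ n)%N ->
  dyadic_increments n x = dyadic_increments n y ->
  x (k%:R / 2 ^+ n) = y (k%:R / 2 ^+ n).
Proof.
move=> + xy; elim: k => [_|k ih kn]; first by rewrite !mul0r !path_at0.
have := congr1 (fun v : _.-tuple _ => v`_k) xy => /=.
by rewrite !nth_dyadic_increments// (ih (ltnW kn)) => /addIr.
Qed.

Lemma increments_nodes (a : R) n (x y : Cpath a) k : (k <= 2 ^ n)%N ->
  increments n x = increments n y ->
  x (a * k%:R / 2 ^+ n) = y (a * k%:R / 2 ^+ n).
Proof.
move=> + xy; elim: k => [_|k ih kn]; first by rewrite !mulr0 !mul0r !path_at0.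
have := congr1 (fun v : _.-tuple _ => tnth v (Ordinal kn)) xy.
by rewrite !tnth_mktuple/= (ih (ltnW kn)) => /addIr.
Qed.

Lemma continuous_increments (a : R) n i :
  continuous (fun x : Cpath a => tnth (increments n x) i : R).
Proof.
rewrite (_ : (fun _ => _) = fun x : Cpath a =>
  x (a * i.+1%:R / 2 ^+ n) - x (a * i%:R / 2 ^+ n)).
  move=> x; apply: (@cvgB _ R _ (nbhs x)); exact: continuous_Cpath_eval.
by apply/funext => x; rewrite tnth_mktuple.
Qed.

(** Let [y n] in [K] share the increments of [x] at level [n]. At every node the values of [y n] are
    those of [x] from some [n] on, so a cluster point of the sequence agrees with [x] at all
    nodes. *)
Lemma compact_bigcap_cylinders (K : set (Cinfty R)) : compact K ->
  K = \bigcap_n dyadic_increments n @^-1` (dyadic_increments n @` K).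
Proof.
move=> cK; apply/seteqP; split=> [x Kx n _|x Kx]; first by exists x.
have /choice[y yP] : forall n, exists y, K y /\
    dyadic_increments n y = dyadic_increments n x.
  by move=> n; have [y Ky yx] := Kx n I; exists y.
have [z Kz zP] := @compact_cluster_seq R _ _ _ cK (fun n => (yP n).1).
suff -> : x = z by [].
apply: (@path_eq_on_nodes _ 1) => [//|t|s t|m k].
- by rewrite /= in_itv/= andbT.
- by move=> _ /andP[s0 _]; rewrite /= in_itv/= s0.
rewrite mul1r => _; apply/esym/(zP (fun u : Cinfty R => u (k%:R / 2 ^+ m))).
  exact: continuous_Cinfty_eval.
(* For [n >= m] the point is a node of level [n], and [n >= k] keeps it within the range [2 ^ n]. *)
apply: cvg_near_cst; exists (m + k)%N => // n /= mkn.
have mn : (m <= n)%N by rewrite (leq_trans _ mkn)// leq_addr.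
have -> : k%:R / 2 ^+ m = (k * 2 ^ (n - m))%:R / 2 ^+ n :> R.
  have -> : 2 ^+ n = 2 ^+ m * 2 ^+ (n - m) :> R by rewrite -exprD subnKC.
  rewrite natrM natrX -mulf_div divff ?mulr1// expf_neq0.
apply: dyadic_increments_nodes; last exact: (yP n).2.
rewrite -[4%N]/(2 * 2)%N expnMn leq_mul//; last by rewrite leq_exp2l// leq_subr.
rewrite ltnW// (leq_trans (ltn_expl k (isT : 1 < 2)%N))// leq_exp2l//.
by rewrite (leq_trans _ mkn)// leq_addl.
Qed.

Lemma Qrestr_preimage_bigcap (r : nat) (K : set (Cpath (r%:R : R))) :
  (0 < r)%N -> compact K -> @Qrestr R r @^-1` K =
  \bigcap_n (increments n \o @Qrestr R r) @^-1` (increments n @` K).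
Proof.
move=> r0 cK; apply/seteqP; split=> [x Kx n _|x Kx]; first by exists (Qrestr r x).
have /choice[y yP] : forall n, exists y, K y /\
    increments n y = increments n (Qrestr r x).
  by move=> n; have [y Ky yx] := Kx n I; exists y.
have [z Kz zP] := @compact_cluster_seq R _ _ _ cK (fun n => (yP n).1).
rewrite /=; suff -> : Qrestr r x = z by [].
apply: (@path_eq_on_nodes _ r%:R) => [|t|s t|m k].
- by rewrite ltr0n.
- by rewrite /= in_itv/= => /andP[].
- by rewrite /= !in_itv/= => /andP[_ tr] /andP[-> /le_trans ->].
move=> kI; have {kI} km : (k <= 2 ^ m)%N.
  move: kI; rewrite /= in_itv/= => /andP[_].
  by rewrite ler_pdivrMr ?exprn_gt0// ler_pM2l ?ltr0n// -natrX ler_nat.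
apply/esym/(zP (fun u : Cpath (r%:R : R) => u (r%:R * k%:R / 2 ^+ m))).
  exact: continuous_Cpath_eval.
apply: cvg_near_cst; exists m => // n mn; rewrite [X in X = _]/=.
have -> : r%:R * k%:R / 2 ^+ m = r%:R * (k * 2 ^ (n - m))%:R / 2 ^+ n :> R.
  have -> : 2 ^+ n = 2 ^+ m * 2 ^+ (n - m) :> R by rewrite -exprD subnKC.
  rewrite natrM natrX mulrA -mulf_div.
  by rewrite divff ?mulr1// expf_neq0.
apply: (increments_nodes _ (yP n).2).
have e2 : (2 ^ n = 2 ^ m * 2 ^ (n - m))%N by rewrite -expnD subnKC.
by rewrite e2 leq_mul2r km orbT.
Qed.

End nodes.

(** * Caratheodory extension to the Borel sets *)

Section wiener_measure.
Context {R : realType}.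

Let outer : {outer_measure set (@cylinder_type R) -> \bar R} :=
  (@cylinder_content R)^*%mu.

Let cara : {measure set (caratheodory_type outer) -> \bar R} := outer.

Let outerE (A : set (@cylinder_type R)) : measurable A ->
  outer A = cylinder_content A.
Proof. by move=> mA; rewrite /outer /= measurable_mu_extE. Qed.

Let cara_cylinder (A : set (@cylinder_type R)) : measurable A ->
  (measurable : set (set (caratheodory_type outer))) A.
Proof.
move=> mA; apply: (@sub_caratheodory _ _ R (@cylinder_content R)).
exact: sub_sigma_algebra.
Qed.

Let cyl_image (K : set (Cinfty R)) n : compact K ->
  (measurable : set (set (@cylinder_type R)))
    (dyadic_increments n @^-1` (dyadic_increments n @` K)).
Proof.
move=> cK; exists n, (dyadic_increments n @` K); split => //.
by apply: measurable_compact_image => // i; exact: continuous_dyadic_increments.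
Qed.

Let cara_compact (K : set (Cinfty R)) : compact K ->
  (measurable : set (set (caratheodory_type outer))) K.
Proof.
move=> cK; rewrite (compact_bigcap_cylinders cK).
by apply: bigcapT_measurable => n; apply: cara_cylinder; exact: cyl_image.
Qed.

Let image_nonincreasing (K : set (Cinfty R)) n m : (n <= m)%N ->
  dyadic_increments m @^-1` (dyadic_increments m @` K) `<=`
  dyadic_increments n @^-1` (dyadic_increments n @` K).
Proof.
move=> nm x [y Ky yx]; exists y => //.
by rewrite !(dyadic_increments_coarsen _ nm) yx.
Qed.

(** The set is the decreasing intersection of cylinders that contain it; each of them satisfies the
    bound, which passes to the limit. *)
Let outer_concentrated (C : R) : 1 <= C ->
  (1 - (120 * 4 ^+ 4 / C)%:E <= outer (dyadic_modulus_le C))%E.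
Proof.
move=> C1.
have cK : compact (dyadic_modulus_le C : set (Cinfty R)).
  by apply: compact_dyadic_modulus; exact: le_trans C1.
pose E n : set (caratheodory_type outer) :=
  dyadic_increments n @^-1` (dyadic_increments n @` dyadic_modulus_le C).
have Ecvg : cara (E n) @[n --> \oo] --> cara (\bigcap_n E n).
  apply: (@nonincreasing_cvg_mu _ _ _ cara E).
  - rewrite /cara /= outerE; last exact: cyl_image.
    apply: le_lt_trans (ltry 1).
    by apply: cylinder_content_le1; exact: cyl_image.
  - by move=> n; apply: cara_cylinder; exact: cyl_image.
  - by apply: bigcapT_measurable => n; apply: cara_cylinder; exact: cyl_image.
  - by move=> n m nm; apply/subsetPset; exact: image_nonincreasing.
rewrite [X in outer X](compact_bigcap_cylinders cK).
rewrite -[leRHS](cvg_lim _ Ecvg)//.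
apply: lime_ge; first exact: cvgP Ecvg.
apply: nearW => n; rewrite /cara/= outerE; last exact: cyl_image.
apply: cylinder_content_concentrated => //; first exact: cyl_image.
by move=> x Cx; exists x.
Qed.

Let outerT : outer setT = 1%E.
Proof. by rewrite outerE// cylinder_contentT. Qed.

(** The compact sets with a dyadic modulus exhaust the space up to outer measure 0, and
    Caratheodory's sigma-algebra is complete. *)
Let outer_negligible (A : set (Cinfty R)) :
  A `<=` ~` (\bigcup_k dyadic_modulus_le k.+1%:R) ->
  (measurable : set (set (caratheodory_type outer))) A.
Proof.
move=> AN; apply: (@measure_is_complete_caratheodory _ _ outer).
have mK k : (measurable : set (set (caratheodory_type outer)))
    (dyadic_modulus_le k.+1%:R).
  by apply: cara_compact; exact: compact_dyadic_modulus.
have mKK : (measurable : set (set (caratheodory_type outer)))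
    (\bigcup_k dyadic_modulus_le k.+1%:R) by exact: bigcupT_measurable.
exists (~` \bigcup_k dyadic_modulus_le k.+1%:R); split => //.
  exact: measurableC.
apply/eqP; rewrite eq_le outer_measure_ge0 andbT.
apply/lee_addgt0Pr => e e0; rewrite add0e.
pose k := Num.truncn (120 * 4 ^+ 4 / e).
have ke : 120 * 4 ^+ 4 / k.+1%:R <= e.
  by rewrite ler_pdivrMr// [leRHS]mulrC -ler_pdivrMr// ltW// truncnS_gt.
apply: (@le_trans _ _ (outer (~` dyadic_modulus_le k.+1%:R))).
  by apply: le_outer_measure; apply: subsetC => x Kx; exists k.
(* Caratheodory's criterion for the compact set, tested on the whole space, makes the two outer
   measures add up to 1. *)
have := mK k setT; rewrite !setTI outerT => eq1.
have : ((1 - 120 * 4 ^+ 4 / k.+1%:R)%:E <=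
    outer (dyadic_modulus_le k.+1%:R))%E.
  by rewrite EFinB; apply: outer_concentrated; rewrite ler1n.
have ge0K := outer_measure_ge0 outer (dyadic_modulus_le k.+1%:R).
have ge0C := outer_measure_ge0 outer (~` dyadic_modulus_le k.+1%:R).
move: eq1 ge0K ge0C.
move: (outer (dyadic_modulus_le _)) (outer (~` _)) => [u| |] [v| |] //=.
rewrite -EFinD => -[uv]; rewrite !lee_fin => u0 v0 h.
apply: le_trans ke; move: (120 * 4 ^+ 4 / _) h uv => c h uv. lra.
Qed.

(** The part of a closed set inside the sigma-compact [KK] is a countable union of compact sets, and
    the rest is negligible. *)
Let borel_caratheodory (A : set (borel (Cinfty R))) : measurable A ->
  (measurable : set (set (caratheodory_type outer))) A.
Proof.
apply: smallest_sub; first exact: sigma_algebra_measurable.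
move=> U oU.
suff cC (F : set (Cinfty R)) : closed F ->
    (measurable : set (set (caratheodory_type outer))) F.
  by rewrite -[U]setCK; apply: measurableC; apply: cC; exact: open_closedC.
move=> cF; pose KK := \bigcup_k (dyadic_modulus_le k.+1%:R : set (Cinfty R)).
rewrite -(setUIDK F KK) setI_bigcupr.
apply: measurableU.
  apply: bigcupT_measurable => k; apply: cara_compact; rewrite setIC.
  by apply: compact_closedI => //; exact: compact_dyadic_modulus.
by apply: outer_negligible => x [].
Qed.

Definition wiener_measure : set (borel (Cinfty R)) -> \bar R :=
  (@cylinder_content R)^*%mu.

Let wiener_measure0 : wiener_measure set0 = 0%E.
Proof. exact: (outer_measure0 outer). Qed.

Let wiener_measure_ge0 A : (0 <= wiener_measure A)%E.
Proof. exact: (outer_measure_ge0 outer). Qed.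

Let wiener_measure_sigma_additive : semi_sigma_additive wiener_measure.
Proof.
move=> F mF tF mUF.
apply: (@measure_semi_sigma_additive _ _ _ cara F) => //.
- by move=> n; exact: borel_caratheodory.
- exact: borel_caratheodory.
Qed.

HB.instance Definition _ := isMeasure.Build _ (borel (Cinfty R)) R
  wiener_measure wiener_measure0 wiener_measure_ge0
  wiener_measure_sigma_additive.

HB.instance Definition _ := Measure_isProbability.Build _ (borel (Cinfty R)) R
  wiener_measure outerT.

Lemma wiener_measure_cylinder n (B : set ((4 ^ n).-tuple (measurableTypeR R))) :
  measurable B -> wiener_measure (dyadic_increments n @^-1` B) = dyadic_law n B.
Proof.
by move=> mB; rewrite -cylinder_contentE//; apply: outerE; exists n, B.
Qed.

Lemma wiener_measure_concentrated (C : R) : 1 <= C ->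
  (1 - (120 * 4 ^+ 4 / C)%:E <= wiener_measure (dyadic_modulus_le C))%E.
Proof. exact: outer_concentrated. Qed.

End wiener_measure.

(** * Identification with the Wiener measures *)

Section wiener_measure_compact.
Context {R : realType}.
Local Notation RR := (measurableTypeR R).
Local Notation P := (@wiener_measure R).

Lemma borel_closed (T : ptopologicalType) (F : set T) :
  closed F -> measurable (F : set (borel T)).
Proof.
move=> cF; rewrite -[F]setCK; apply: measurableC.
by apply: sub_sigma_algebra; exact: closed_openC.
Qed.

Lemma Cinfty_hausdorff : hausdorff_space (Cinfty R).
Proof. exact: metric_hausdorff. Qed.

Lemma borel_compact (K : set (Cinfty R)) :
  compact K -> measurable (K : set (borel (Cinfty R))).
Proof.
move=> cK; apply: borel_closed; apply: compact_closed cK.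
exact: Cinfty_hausdorff.
Qed.

Lemma preimage_increments_Qrestr (r n : nat) (B : set ((2 ^ n).-tuple RR)) :
  (increments n \o @Qrestr R r) @^-1` B = dyadic_increments (n + r)
    @^-1` (block_sums (r * 2 ^ (n + r - n)) 0 (2 ^ n) @^-1` B).
Proof.
have r2 : (r <= 2 ^ (n + r))%N.
  by rewrite ltnW// (leq_trans (ltn_expl r (isT : 1 < 2)%N))// leq_exp2l// leq_addl.
by apply/seteqP; split => x /=; rewrite (increments_coarsen x (leq_addr r n) r2).
Qed.

Lemma wiener_measure_increments (r n : nat) (B : set ((2 ^ n).-tuple RR)) :
  (0 < r)%N -> measurable B ->
  P ((increments n \o @Qrestr R r) @^-1` B) = nu r%:R n B.
Proof.
move=> r0 mB; rewrite preimage_increments_Qrestr wiener_measure_cylinder; last first.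
  exact: measurable_preimage_block_sums.
apply: nu_coarsen => //; first exact: leq_addr.
by rewrite ltnW// (leq_trans (ltn_expl r (isT : 1 < 2)%N))// leq_exp2l// leq_addl.
Qed.

Lemma measurable_continuous_borel (T : ptopologicalType) (g : T -> R) :
  continuous g -> measurable_fun setT (g : borel T -> RR).
Proof.
move=> cg; apply: (measurability _ (RGenOInfty.measurableE R)).
move=> _ [_ [c ->] <-]; rewrite setTI; apply: sub_sigma_algebra.
by apply: open_comp => [x _|]; [exact: cg|exact: interval_open].
Qed.

Lemma measurable_increments_Qrestr (r n : nat) (B : set ((2 ^ n).-tuple RR)) :
  measurable B -> measurable ((increments n \o @Qrestr R r) @^-1` B
    : set (borel (Cinfty R))).
Proof.
move=> mB; rewrite preimage_increments_Qrestr.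
have mf : measurable_fun setT (@dyadic_increments R (n + r)
    : borel (Cinfty R) -> (4 ^ (n + r)).-tuple RR).
  apply/measurable_fun_tnthP => i; apply: measurable_continuous_borel.
  exact: continuous_dyadic_increments.
rewrite -[X in measurable X]setTI; apply: mf => //.
exact: measurable_preimage_block_sums.
Qed.

Lemma increments_refine (a : R) n m (x y : Cpath a) : (n <= m)%N ->
  increments m x = increments m y -> increments n x = increments n y.
Proof.
move=> nm xy; apply: eq_from_tnth => i; rewrite !tnth_mktuple.
have node k : (k <= 2 ^ n)%N ->
    x (a * k%:R / 2 ^+ n) = y (a * k%:R / 2 ^+ n).
  move=> kn; have -> : a * k%:R / 2 ^+ n = a * (k * 2 ^ (m - n))%:R / 2 ^+ m :> R.
    have -> : 2 ^+ m = 2 ^+ n * 2 ^+ (m - n) :> R by rewrite -exprD subnKC.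
    by rewrite natrM natrX mulrA -mulf_div divff ?mulr1// expf_neq0.
  apply: (increments_nodes _ xy).
  have -> : (2 ^ m = 2 ^ n * 2 ^ (m - n))%N by rewrite -expnD subnKC.
  by rewrite leq_mul2r kn orbT.
by rewrite !node// ltnW.
Qed.

Lemma measurable_increments_image (a : R) (K : set (Cpath a)) n : compact K ->
  measurable (increments n @` K).
Proof.
by move=> cK; apply: measurable_compact_image => // i; exact: continuous_increments.
Qed.

(** By [alpha_preimage] the terms of the limit are the measures of the cylinders [E n], which
    decrease to the preimage of [K]. *)
Lemma phi_compact (r : nat) (K : set (Cpath (r%:R : R))) : (0 < r)%N ->
  compact K -> phi K = P (@Qrestr R r @^-1` K).
Proof.
move=> r0 cK; apply/cvg_lim => //.
pose E n : set (borel (Cinfty R)) :=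
  (increments n \o @Qrestr R r) @^-1` (increments n @` K).
have mE n : measurable (E n).
  by apply: measurable_increments_Qrestr; exact: measurable_increments_image.
rewrite (_ : (fun n => _) = P \o E); last first.
  apply/funext => n /=; rewrite alpha_preimage ?ltr0n//.
  rewrite /E wiener_measure_increments//.
  exact: measurable_increments_image.
rewrite Qrestr_preimage_bigcap//.
apply: (@nonincreasing_cvg_mu _ _ _ P E) => //.
- by rewrite (le_lt_trans (probability_le1 _ _)) ?ltry.
- exact: bigcapT_measurable.
- move=> n m nm; apply/subsetPset => x [y Ky yx]; exists y => //.
  exact: increments_refine yx.
Qed.

Lemma measurable_Qrestr_preimage (r : nat) (K : set (Cpath (r%:R : R))) :
  (0 < r)%N -> compact K ->
  measurable (@Qrestr R r @^-1` K : set (borel (Cinfty R))).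
Proof.
move=> r0 cK; rewrite Qrestr_preimage_bigcap//.
apply: bigcapT_measurable => n; apply: measurable_increments_Qrestr.
exact: measurable_increments_image.
Qed.

(** On compact sets [phi] is monotone, being a measure of preimages, so the supremum is attained at
    [K] itself. *)
Lemma wiener_compact (r : nat) (K : set (Cpath (r%:R : R))) : (0 < r)%N ->
  compact K -> wiener K = P (@Qrestr R r @^-1` K).
Proof.
move=> r0 cK; apply/eqP; rewrite eq_le; apply/andP; split.
  apply: ge_ereal_sup => _ [L [cL LK] <-]; rewrite phi_compact//.
  apply: le_measure; rewrite ?inE; try exact: measurable_Qrestr_preimage.
  exact: preimage_subset.
by rewrite -phi_compact//; apply: ereal_sup_ubound; exists K; first by split.
Qed.

Lemma wiener_infty_compactE (K : set (Cinfty R)) : compact K ->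
  wiener_infty_compact K = P K.
Proof.
(* The index 0 is dropped, as [wiener_compact] requires [0 < r]. *)
move=> cK; apply/cvg_lim => //; rewrite -cvg_shiftS.
have cQK r : compact (@Qrestr R r @` K).
  apply: continuous_compact => //; apply: continuous_subspaceT.
  exact: continuous_Qrestr.
pose E r : set (borel (Cinfty R)) := @Qrestr R r.+1 @^-1` (@Qrestr R r.+1 @` K).
have mE r : measurable (E r) by exact: measurable_Qrestr_preimage.
rewrite [X in X @ _](_ : _ = P \o E); last first.
  by apply/funext => r /=; rewrite wiener_compact.
have Qin (x : Cinfty R) (r : nat) t : 0 <= t <= r%:R -> Qrestr r x t = x t.
  by move=> tr; rewrite /= /patch mem_set//= in_itv.
(* If for every [r] some [y r] in [K] agrees with [x] on [[0, r + 1]], a cluster point of this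
   sequence agrees with [x] at all times. *)
have KE : K = \bigcap_r E r.
  apply/seteqP; split=> [x Kx r _|x Kx]; first by exists x.
  have /choice[y yP] : forall r, exists y, K y /\ Qrestr r.+1 y = Qrestr r.+1 x.
    by move=> r; have [y Ky yx] := Kx r I; exists y.
  have [z Kz zP] := @compact_cluster_seq R _ _ _ cK (fun n => (yP n).1).
  suff -> : x = z by [].
  apply: path_onP => t; rewrite /= in_itv/= andbT => t0.
  apply/esym/(zP (fun u : Cinfty R => u t)); first exact: continuous_Cinfty_eval.
  apply: cvg_near_cst; exists (Num.truncn t) => // n tn.
  have tr : 0 <= t <= n.+1%:R.
    by rewrite t0 ltW// (lt_le_trans (truncnS_gt t))// ler_nat.
  by rewrite -(Qin (y n) _ _ tr) (yP n).2 Qin.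
rewrite [X in _ --> P X]KE.
apply: (@nonincreasing_cvg_mu _ _ _ P E) => //.
- by rewrite (le_lt_trans (probability_le1 _ _)) ?ltry.
- exact: bigcapT_measurable.
- move=> r s rs; apply/subsetPset => x [y Ky yx]; exists y => //.
  apply: path_onP => t tI; have tr : 0 <= t <= r.+1%:R.
    by move: tI; rewrite /= in_itv.
  have ts : 0 <= t <= s.+1%:R.
    by case/andP: tr => -> /le_trans -> //; rewrite ler_nat.
  by rewrite !Qin// -(Qin y _ _ ts) yx Qin.
Qed.

Lemma borel_sandwiched (A : set (borel (Cinfty R))) : measurable A ->
  sandwiched (idfun : Cinfty R -> borel (Cinfty R)) P A.
Proof.
apply: smallest_sub; first exact: sandwiched_sigma_algebra.
move=> U oU.
(* [F k] leaves out an open neighbourhood of size [1 / k.+1] of every point outside [U]; these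
   closed sets fill up [U]. *)
pose F k : set (Cinfty R) := ~` \bigcup_(y in ~` U) (ball y k.+1%:R^-1)°.
have cF k : closed (F k).
  by apply: open_closedC; apply: bigcup_open => y _; exact: open_interior.
apply: (@sandwiched_open R (Cinfty R) _ (borel (Cinfty R)) idfun P U F) => //.
- exact: sub_sigma_algebra.
- by move=> n; exact: borel_closed.
apply/seteqP; split=> [x Ux|x [k _ Fx]].
  have /nbhs_ballP[e /= e0 eU] : nbhs x U by exact: open_nbhs_nbhs.
  exists (Num.truncn e^-1) => // -[y nUy /interior_subset xy]; apply: nUy.
  apply: eU; apply: le_ball (ball_sym xy).
  by rewrite -[leRHS]invrK lef_pV2 ?posrE ?invr_gt0// ltW// truncnS_gt.
apply: contrapT => nUx; apply: Fx; exists x => //.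
by apply: nbhsx_ballx; rewrite invr_gt0.
Qed.

(** An inner closed set is intersected with a compact set of large measure; each of the two
    approximations loses at most [e / 2]. *)
Lemma wiener_measure_inner_regular (A : set (borel (Cinfty R))) (e : R) :
  measurable A -> 0 < e -> exists K : set (Cinfty R),
    [/\ compact K, K `<=` A & (P A <= P K + e%:E)%E].
Proof.
move=> mA e0; have e20 : 0 < e / 2 by rewrite divr_gt0.
have [_ /(_ _ e20)[F [U [mF mU cF oU [FA AU UF]]]]] := borel_sandwiched mA.
pose C : R := 1 + 120 * 4 ^+ 4 / (e / 2).
have C1 : 1 <= C by rewrite lerDl divr_ge0 ?ltW// mulr_ge0// exprn_ge0.
have C0 : 0 < C by rewrite (lt_le_trans _ C1).
have Ce : 120 * 4 ^+ 4 / C <= e / 2.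
  by rewrite ler_pdivrMr// [leRHS]mulrC -ler_pdivrMr// lerDr.
have cK : compact (dyadic_modulus_le C : set (Cinfty R)).
  by apply: compact_dyadic_modulus; exact: ltW.
have mK : measurable (dyadic_modulus_le C : set (borel (Cinfty R))).
  exact: borel_compact.
exists (dyadic_modulus_le C `&` F); split.
- by apply: compact_closedI.
- by move=> x [_ /FA].
have mKF : measurable (dyadic_modulus_le C `&` F : set (borel (Cinfty R))).
  exact: measurableI.
have PKC : (P (~` (dyadic_modulus_le C : set (borel (Cinfty R)))) <= (e / 2)%:E)%E.
  rewrite probability_setC// leeBlDr; last exact: fin_num_measure.
  rewrite addeC; apply: (@le_trans _ _ (P (dyadic_modulus_le C) +
      (120 * 4 ^+ 4 / C)%:E)%E); last by rewrite leeD2l// lee_fin.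
  by rewrite -leeBlDr//; exact: wiener_measure_concentrated.
apply: (@le_trans _ _ (P ((dyadic_modulus_le C `&` F) `|`
    ((U `\` F) `|` ~` (dyadic_modulus_le C : set (borel (Cinfty R))))))).
  apply: le_measure; rewrite ?inE//.
    by apply: measurableU => //; apply: measurableU;
      [exact: measurableD|exact: measurableC].
  move=> x Ax; have [Cx|] := pselect (dyadic_modulus_le C x); last by right; right.
  have [Fx|nFx] := pselect (F x); first by left.
  by right; left; split => //; exact: AU.
have mUF : measurable (U `\` F) by exact: measurableD.
have mKC : measurable (~` (dyadic_modulus_le C : set (borel (Cinfty R)))).
  exact: measurableC.
apply: (le_trans (measureU2 _ _ _)) => //; first exact: measurableU.
apply: leeD => //; apply: (le_trans (measureU2 _ _ _)) => //.
by rewrite [e]splitr EFinD; exact: leeD.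
Qed.

End wiener_measure_compact.

Theorem mainTheorem2 (R : realType) :
  exists P : probability (borel (Cinfty R)) R,
    (forall K : set (Cinfty R), compact K -> P K = wiener_infty_compact K) /\
    (forall A : set (borel (Cinfty R)), measurable A -> P A = wiener_infty A).
Proof.
exists (@wiener_measure R); split=> [K cK|A mA].
  by rewrite wiener_infty_compactE.
(* Inner regularity gives one inequality, monotonicity of the measure the other. *)
apply/eqP; rewrite eq_le; apply/andP; split.
  apply/lee_addgt0Pr => e e0.
  have [K [cK KA AK]] := wiener_measure_inner_regular mA e0.
  apply: (le_trans AK); apply: leeD => //.
  rewrite -wiener_infty_compactE//.
  by apply: ereal_sup_ubound; exists K; first by split.
apply: ge_ereal_sup => _ [K [cK KA] <-]; rewrite wiener_infty_compactE//.
by apply: le_measure; rewrite ?inE//; exact: borel_compact.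
Qed.
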